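(* Let $n\ge 1$, $\vec a=(a_0,\dots,a_n)\in\mathbb{Z}^{n+1}$, and let $G=G_{\vec a}$ be the finite directed graph defined in the context, with the associated polyhedra $Q_T$ and integers $d(T)$, $n(T)$ for finite paths $T$ in $G$. Then: (i) for every path $T$ in $G$ of (finite) length $k\ge 0$, $\dim(Q_T)=d(T)+n(T)$; (ii) for every $k\ge 0$, the set $D(k+n)$ of all tropical recurrent sequences of length $k+n$ satisfying $\vec a$ coincides with $\bigcup_T Q_T$, where $T$ ranges over all paths in $G$ of length $k$; (iii) for every $k\ge 0$, the tropical Hilbert function satisfies $d_{\vec a}(k+n)=\max_T\{d(T)+n(T)\}$, where $T$ ranges over all paths in $G$ of length $k$.
   Context: Let $n\ge 1$, $\vec a=(a_0,\dots,a_n)\in\mathbb{Z}^{n+1}$, $M:=\max_i a_i-\min_i a_i$. A sequence $(z_1,\dots,z_k)\in\mathbb{R}^k$ (or an infinite real sequence) satisfies $\vec a$ if for every $j\ge1$ for which $z_{j+n}$ is a term of the sequence, the minimum $\min_{0\le i\le n}\{z_{j+i}+a_i\}$ is attained for at least two different $i$; such sequences are called tropical recurrent sequences satisfying $\vec a$. $D(k)\subset\mathbb{R}^k$ is the set of all such sequences of length $k$ (so $D(k)=\mathbb{R}^k$ for $k\le n$); it is a finite union of polyhedra, and $d_{\vec a}(k):=\dim D(k)$ (maximal dimension of a polyhedron in it) is the tropical Hilbert function. Polyhedra are allowed to be defined by linear equations and by strict and non-strict linear inequalities. Vertices of $G$. A vertex $v$ is given by: a nonempty set $B=B_v\subset\{1,\dots,n\}$;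 an element $s=s_v\in B$; and, for each pair $r<l$ in $B$, an integer $m(r,l)=m_v(r,l)$ and an indicator $e(r,l)=e_v(r,l)\in\{0,1\}$, such that $m(s,q)\ge -nM$ for $q\in B$, $q>s$; $m(p,s)\le (n+s-p)M$ for $p\in B$, $p<s$; $|m(r,l)|\le 2nM$ for all $r<l$ in $B$; and such that the polyhedron $P_v\subset\mathbb{R}^n$ is nonempty, where $P_v$ is the set of $(y_1,\dots,y_n)$ with - $y_s\le y_j$ for $1\le j\le n$; - $y_r=y_l+m(r,l)$ for $r<l$ in $B$ with $e(r,l)=0$; - $y_r-1<y_l+m(r,l)<y_r$ for $r<l$ in $B$ with $e(r,l)=1$; - $y_j-y_s>jM$ for $1\le j\le n$, $j\notin B$. Here $s$ is the smallest element of $B$ at which the minimum of the coordinates is attained on $P_v$. Coordinates with index in $B$ are called bounded, the others unbounded. All such data with $P_v\neq\emptyset$ give the vertices of $G$. The relation ''$r=l$ or $e(r,l)=0$'' is an equivalence relation on $B$. The set $S_v$. For $(y_1,\dots,y_n)\in P_v$, the set $S=S_v$ of $r\in\{1,\dots,n\}$ at which $\min_{1\le r\le n}\{y_r+a_{r-1}\}$ is attained is contained in $B_v$ and does not depend on the chosen point of $P_v$. Edges of $G$. Let $v$ be a vertex, $B=B_v$, $B^-:=\{r-1: r\in B,\ r\ge 2\}$. For every edge $(v,w)$ one requires $m_w(r-1,l-1)=m_v(r,l)$ and $e_w(r-1,l-1)=e_v(r,l)$ for all $r<l$ in $B$ with $r\ge2$. The edges from $v$ are exactly the following. (E1) If $S_v=\{t\}$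 is a singleton: there is exactly one edge from $v$, to the vertex $w$ with $B_w=B^-\cup\{n\}$, where, putting $x_i=y_{i+1}$ ($1\le i<n$) and $x_n=y_t+a_{t-1}-a_n$ for a point $y\in P_v$, one sets for $r\in B^-$: $m_w(r,n)=\lfloor x_r-x_n\rfloor$, and $e_w(r,n)=0$ if $x_r-x_n\in\mathbb{Z}$, $e_w(r,n)=1$ otherwise (this does not depend on $y$); $s_w$ is the smallest element of $B_w$ at which $\min_{i\in B_w}x_i$ is attained. If $|S_v|\ge2$, let $t$ be the smallest element of $S_v$ with $t>1$, and let $s'$ be the smallest element of $B^-$ at which $\min_{i\in B^-}y_{i+1}$ is attained (independent of $y\in P_v$). Then the edges from $v$ are: (E2) one edge to the vertex $w$ with $B_w=B^-$, $s_w=s'$ (so $n$ is unbounded, and $x_n-x_{s'}>nM$ on $P_w$); (E3) an edge to every vertex $w$ with $B_w=B^-\cup\{n\}$ (and $m_w,e_w$ on $B^-$ as prescribed above) such that $m_w(t-1,n)\le a_n-a_{t-1}-e_w(t-1,n)$ and $m_w(s',n)\ge -nM$. An edge $(v,w)$ is called rigid if for a point $(y_1,\dots,y_n)\in P_v$ there is a unique $x\in\mathbb{R}$ such that $(y_1,\dots,y_n,x)$ satisfies $\vec a$ and $(y_2,\dots,y_n,x)\in P_w$; it is called augmenting if these $x$ run over an open interval (every edge is rigid or augmenting, independently of the point of $P_v$). A path $T$ of length $k$ is a sequence of vertices $v_0,\dots,v_k$ such that each $(v_i,v_{i+1})$ is an edge. $Q_T\subset\mathbb{R}^{k+n}$ is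 the polyhedron of all sequences $(y_1,\dots,y_{k+n})$ produced along $T$, i.e. satisfying $\vec a$ and such that $(y_{i+1},\dots,y_{i+n})\in P_{v_i}$ for $0\le i\le k$. $d(T)$ is the number of augmenting edges of $T$ (counted along the path), and $n(T)\le n$ is the number of equivalence classes of coordinates in the first vertex $v_0$: the number of equivalence classes on $B_{v_0}$ plus the number of unbounded coordinates (each forming its own class). *)

(* Defs.v *)
From HB Require Import structures.
From mathcomp Require Import all_boot all_order all_algebra.
From mathcomp Require Import all_classical all_reals all_analysis.

Set Implicit Arguments.
Unset Strict Implicit.
Unset Printing Implicit Defensive.

Import Order.TTheory GRing.Theory Num.Theory.
Import numFieldNormedType.Exports.

Local Open Scope classical_set_scope.
Local Open Scope ring_scope.

(* Indices are 0-based: [r : 'I_n] stands for the coordinate y_{r+1}, so the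
   coefficient a_{r-1} attached to y_r in 1-based notation is here [acoef a r],
   the last coordinate y_n is the [q : 'I_n] with [q.+1 = n], and the shift
   r |-> r - 1, r >= 2, is the relation [r = r'.+1 :> nat]. *)

(** * Polyhedra and dimension *)

Definition dotr (R : realType) (N : nat) (c x : 'rV[R]_N) : R :=
  \sum_(i < N) c 0 i * x 0 i.

Definition is_polyhedron (R : realType) (N : nat) (A : set 'rV[R]_N) : Prop :=
  exists Eq Le Lt : seq ('rV[R]_N * R),
    A = [set x | [/\ forall c, c \in Eq -> dotr c.1 x = c.2,
                     forall c, c \in Le -> dotr c.1 x <= c.2 &
                     forall c, c \in Lt -> dotr c.1 x < c.2]].

Definition affine_hull (R : realType) (N : nat) (A : set 'rV[R]_N) :
    set 'rV[R]_N :=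
  [set x | exists (h : nat) (p : 'I_h -> 'rV[R]_N) (c : 'I_h -> R),
     [/\ forall i, A (p i), \sum_i c i = 1 & x = \sum_i c i *: p i]].

(* The dimension of a set is that of its affine hull; the empty set has none. *)
Definition has_dim (R : realType) (N : nat) (A : set 'rV[R]_N) (d : nat) :
    Prop :=
  exists (x0 : 'rV[R]_N) (U : {vspace 'rV[R]_N}),
    affine_hull A = [set x | x - x0 \in U] /\ \dim U = d.

(** * Tropical recurrent sequences *)

(* The junk value 0 outside the range is never reached below. *)
Definition coord (R : realType) (N : nat) (z : 'rV[R]_N) (j : nat) : R :=
  if insub j is Some i then z 0 i else 0.

Definition window (R : realType) (n N : nat) (z : 'rV[R]_N) (i : nat) :
    'rV[R]_n :=
  \row_(r < n) coord z (i + r).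

Definition argmin (R : realType) (m : nat) (f : 'I_m -> R) : {set 'I_m} :=
  [set i | [forall j, f i <= f j]]%SET.

Definition satisfies (R : realType) (n : nat) (a : 'I_n.+1 -> int)
    (N : nat) (z : 'rV[R]_N) : Prop :=
  forall j : nat, (j + n < N)%N ->
    (2 <= #|argmin (fun i : 'I_n.+1 => (coord z (j + i) + (a i)%:~R)%R)|)%N.

Definition trop_seqs (R : realType) (n : nat) (a : 'I_n.+1 -> int) (N : nat) :
    set 'rV[R]_N :=
  [set z | satisfies a z].
Arguments trop_seqs R {n} a N.

(* The largest dimension of a polyhedron contained in D(N). *)
Definition trop_hilbert (R : realType) (n : nat) (a : 'I_n.+1 -> int)
    (N : nat) : nat :=
  (\max_(d < N.+1 | `[< exists A : set 'rV[R]_N,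
       [/\ is_polyhedron A, A `<=` trop_seqs R a N & has_dim A d] >]) d)%N.

(** * Vertices of the graph *)

Definition amplitude (n : nat) (a : 'I_n.+1 -> int) : int :=
  \big[Num.max/a ord0]_i a i - \big[Num.min/a ord0]_i a i.

Definition acoef (n : nat) (a : 'I_n.+1 -> int) (r : 'I_n) : int :=
  a (widen_ord (leqnSn n) r).

Record vdata (n : nat) := VData {
  vB : {set 'I_n};
  vs : 'I_n;
  vm : 'M[int]_n;
  ve : 'M[bool]_n }.

Definition vpair (n : nat) (v : vdata n) (r l : 'I_n) : bool :=
  [&& r \in vB v, l \in vB v & (r < l)%N].

Definition cell (R : realType) (n : nat) (a : 'I_n.+1 -> int) (v : vdata n) :
    set 'rV[R]_n :=
  [set y : 'rV[R]_n |
    [/\ forall j, y 0 (vs v) <= y 0 j,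
        forall r l, vpair v r l -> ~~ ve v r l ->
          y 0 r = y 0 l + (vm v r l)%:~R,
        forall r l, vpair v r l -> ve v r l ->
          y 0 r - 1 < y 0 l + (vm v r l)%:~R < y 0 r &
        forall j, j \notin vB v ->
          (j.+1%:Z * amplitude a)%:~R < y 0 j - y 0 (vs v)]].
Arguments cell R {n} a v.

Definition first_min (R : realType) (n : nat) (A : {set 'I_n}) (f : 'I_n -> R)
    (s : 'I_n) : Prop :=
  [/\ s \in A, forall i, i \in A -> f s <= f i &
      forall i, i \in A -> (i < s)%N -> f s < f i].

(* The inequalities defining the cell allow ties, so that s is the *smallest*
   minimiser is a separate condition.
   The numbers m(r,l), e(r,l) only exist for r < l in B; the last clause fixes
   the unused matrix entries, so that distinct records are distinct vertices. *)
Definition is_vertex (R : realType) (n : nat) (a : 'I_n.+1 -> int)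
    (v : vdata n) : Prop :=
  [/\ vs v \in vB v,
      [/\ forall q, q \in vB v -> (vs v < q)%N ->
            - (n%:Z * amplitude a) <= vm v (vs v) q,
          forall p, p \in vB v -> (p < vs v)%N ->
            vm v p (vs v) <= (n%:Z + (vs v)%:Z - p%:Z) * amplitude a &
          forall r l, vpair v r l -> `|vm v r l| <= 2 * n%:Z * amplitude a],
      cell R a v !=set0,
      forall y, cell R a v y -> first_min (vB v) (y 0) (vs v) &
      forall r l, ~~ vpair v r l -> vm v r l = 0 /\ ve v r l = false].

Definition vequiv (n : nat) (v : vdata n) (r l : 'I_n) : bool :=
  [|| r == l, (r < l)%N && ~~ ve v r l | (l < r)%N && ~~ ve v l r].

Definition nclasses (n : nat) (v : vdata n) : nat :=
  (#|equivalence_partition (vequiv v) (vB v)| + #|~: vB v|)%N.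

(* The set of minimisers of y_r + a_{r-1} is the same at all points of the
   cell of a vertex. *)
Definition vS (R : realType) (n : nat) (a : 'I_n.+1 -> int) (v : vdata n) :
    {set 'I_n} :=
  [set r | `[< exists2 y : 'rV[R]_n, cell R a v y &
      r \in argmin (fun i => y 0 i + (acoef a i)%:~R) >]]%SET.

(** * Edges of the graph *)

Definition snoc (R : realType) (n : nat) (y : 'rV[R]_n) (x : R) :
    'rV[R]_(n + 1) :=
  row_mx y (const_mx x).

(* (y_2, ..., y_n, x) *)
Definition slide (R : realType) (n : nat) (y : 'rV[R]_n) (x : R) : 'rV[R]_n :=
  window n (snoc y x) 1.

Definition Bminus (n : nat) (B : {set 'I_n}) : {set 'I_n} :=
  [set j : 'I_n | [exists r in B, r == j.+1 :> nat]]%SET.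

Definition Bplus (n : nat) (B : {set 'I_n}) : {set 'I_n} :=
  (Bminus B :|: [set q : 'I_n | q.+1 == n])%SET.

Definition edge_compat (n : nat) (v w : vdata n) : Prop :=
  forall r l r' l' : 'I_n, vpair v r l ->
    r = r'.+1 :> nat -> l = l'.+1 :> nat ->
    vm w r' l' = vm v r l /\ ve w r' l' = ve v r l.

Definition edge1 (R : realType) (n : nat) (a : 'I_n.+1 -> int)
    (v w : vdata n) : Prop :=
  exists (t : 'I_n) (y x : 'rV[R]_n),
    [/\ vS R a v = [set t]%SET,
        cell R a v y /\
          x = slide y (y 0 t + (acoef a t)%:~R - (a ord_max)%:~R),
        vB w = Bplus (vB v),
        forall r q : 'I_n, r \in Bminus (vB v) -> q.+1 = n ->
          vm w r q = Num.floor (x 0 r - x 0 q) /\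
          ve w r q = (x 0 r - x 0 q \isn't a Num.int) &
        first_min (vB w) (x 0) (vs w)].

(* The smallest t > 1 of S_v, the index 1 being 0 here. *)
Definition is_t (R : realType) (n : nat) (a : 'I_n.+1 -> int) (v : vdata n)
    (t : 'I_n) : Prop :=
  [/\ t \in vS R a v, (0 < t)%N &
      forall t', t' \in vS R a v -> (0 < t')%N -> (t <= t')%N].

Definition is_s' (R : realType) (n : nat) (a : 'I_n.+1 -> int) (v : vdata n)
    (s' : 'I_n) : Prop :=
  exists2 y : 'rV[R]_n, cell R a v y &
    first_min (Bminus (vB v)) (fun i => coord y i.+1) s'.

Definition edge2 (R : realType) (n : nat) (a : 'I_n.+1 -> int)
    (v w : vdata n) : Prop :=
  [/\ (2 <= #|vS R a v|)%N, vB w = Bminus (vB v) & is_s' R a v (vs w)].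

Definition edge3 (R : realType) (n : nat) (a : 'I_n.+1 -> int)
    (v w : vdata n) : Prop :=
  (2 <= #|vS R a v|)%N /\
  exists t t1 s' q : 'I_n,
    [/\ is_t R a v t /\ t = t1.+1 :> nat,
        is_s' R a v s' /\ q.+1 = n,
        vB w = Bplus (vB v),
        vm w t1 q <= a ord_max - acoef a t - (ve w t1 q : nat)%:Z &
        - (n%:Z * amplitude a) <= vm w s' q].

Definition edge (R : realType) (n : nat) (a : 'I_n.+1 -> int)
    (v w : vdata n) : Prop :=
  [/\ is_vertex R a v, is_vertex R a w, edge_compat v w &
      [\/ edge1 R a v w, edge2 R a v w | edge3 R a v w]].

Definition extensions (R : realType) (n : nat) (a : 'I_n.+1 -> int)
    (w : vdata n) (y : 'rV[R]_n) : set R :=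
  [set x | satisfies a (snoc y x) /\ cell R a w (slide y x)].

(* Whether the extensions fill an open (possibly unbounded) interval does not
   depend on the point of the cell. *)
Definition augmenting (R : realType) (n : nat) (a : 'I_n.+1 -> int)
    (v w : vdata n) : Prop :=
  exists2 y : 'rV[R]_n, cell R a v y &
    [/\ extensions a w y !=set0, is_interval (extensions a w y) &
        open (extensions a w y)].

(** * Paths *)

Definition psrc (n k : nat) (T : 'I_k.+1 -> vdata n) (i : 'I_k) : vdata n :=
  T (widen_ord (leqnSn k) i).

Definition ptgt (n k : nat) (T : 'I_k.+1 -> vdata n) (i : 'I_k) : vdata n :=
  T (lift ord0 i).

Definition is_path (R : realType) (n : nat) (a : 'I_n.+1 -> int) (k : nat)
    (T : 'I_k.+1 -> vdata n) : Prop :=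
  (forall i, is_vertex R a (T i)) /\
  (forall i : 'I_k, edge R a (psrc T i) (ptgt T i)).

Definition path_poly (R : realType) (n : nat) (a : 'I_n.+1 -> int) (k : nat)
    (T : 'I_k.+1 -> vdata n) : set 'rV[R]_(k + n) :=
  [set z | satisfies a z /\
           forall i : 'I_k.+1, cell R a (T i) (window n z i)].
Arguments path_poly R {n} a {k} T.

Definition path_d (R : realType) (n : nat) (a : 'I_n.+1 -> int) (k : nat)
    (T : 'I_k.+1 -> vdata n) : nat :=
  #|[set i : 'I_k | `[< augmenting R a (psrc T i) (ptgt T i) >]]%SET|.

Definition path_n (n k : nat) (T : 'I_k.+1 -> vdata n) : nat :=
  nclasses (T ord0).

(* Main.v *)
(** A vertex fixes, for the bounded coordinates, the floors of their pairwise
    differences and whether these are integers. Its cell is therefore relatively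
    open in the subspace where coordinates of one class keep constant distance,
    so its dimension is the number of classes, an unbounded coordinate being a
    class of its own. Every comparison y_r - y_l <= c
    with c an integer has the same answer on the whole cell; hence, along an
    edge, either the next term is y_r + c with r and c independent of the point
    (dimension unchanged), or it ranges over a nonempty open interval (dimension
    + 1).
    Conversely, minima of consecutive windows of a sequence satisfying [a]
    differ by at most M. Declaring a term bounded when it is within min(q, n) M of the
    minimum of the first window (of n terms) containing it, q being its
    position, makes all windows lie in cells that form a path.
    Finally there are finitely many paths of given length, and a convex set
    covered by finitely many affine subspaces lies in one of them. *)

Require Import Defs.
From HB Require Import structures.
From mathcomp Require Import all_boot all_order all_algebra.
From mathcomp Require Import all_classical all_reals all_analysis.
From mathcomp Require Import zify ring lra.

Set Implicit Arguments.
Unset Strict Implicit.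
Unset Printing Implicit Defensive.

Import Order.TTheory GRing.Theory Num.Theory.
Import numFieldNormedType.Exports.
Import Defs.

Local Open Scope classical_set_scope.
Local Open Scope ring_scope.

(** * Floors and cells *)

(** For [d] the difference of coordinates [r] and [l], this is the pair formed by m(r,l) and
    e(r,l). *)
Definition floor_type (R : realType) (d : R) : int * bool :=
  (Num.floor d, d \isn't a Num.int).

Section FloorType.
Context {R : realType}.
Implicit Types (d : R) (c m : int).

Lemma floor_type_le d c :
  (d <= c%:~R) = ((floor_type d).1 + ((floor_type d).2 : nat)%:Z <= c).
Proof. by rewrite -ceil_le_int ceil_floor. Qed.

Lemma floor_type_ge d c : (c%:~R <= d) = (c <= (floor_type d).1).
Proof. by rewrite -floor_ge_int. Qed.

(** The floor is the largest integer below [d], and [d] is an integer exactly when it is at most its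
    floor. So the floor type is the record of all comparisons with integers, and invariance under
    negation and integer shifts reduces to moving an inequality. *)
Lemma eq_floor_type d d' :
  (forall c, (d <= c%:~R) = (d' <= c%:~R)) ->
  (forall c, (c%:~R <= d) = (c%:~R <= d')) -> floor_type d = floor_type d'.
Proof.
move=> dle dge.
have fE : Num.floor d = Num.floor d'.
  apply/le_anti/andP; split; rewrite floor_ge_int.
    by rewrite -dge floor_le.
  by rewrite dge floor_le.
rewrite /floor_type fE; congr (_, ~~ _).
rewrite !intrEfloor !eq_le !floor_le -fE /=.
exact: dle.
Qed.

Lemma eq_floor_type_le d d' c :
  floor_type d = floor_type d' -> (d <= c%:~R) = (d' <= c%:~R).
Proof. by move=> dd'; rewrite !floor_type_le dd'. Qed.

Lemma eq_floor_type_ge d d' c :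
  floor_type d = floor_type d' -> (c%:~R <= d) = (c%:~R <= d').
Proof. by move=> dd'; rewrite !floor_type_ge dd'. Qed.

Lemma floor_typeN d d' :
  floor_type d = floor_type d' -> floor_type (- d) = floor_type (- d').
Proof.
move=> dd'; apply: eq_floor_type => c.
  by rewrite [LHS]lerNl [RHS]lerNl -mulrNz (eq_floor_type_ge _ dd').
by rewrite [LHS]lerNr [RHS]lerNr -mulrNz (eq_floor_type_le _ dd').
Qed.

Lemma floor_typeDz d d' c :
  floor_type d = floor_type d' ->
  floor_type (d + c%:~R) = floor_type (d' + c%:~R).
Proof.
move=> dd'; apply: eq_floor_type => b.
  by rewrite -!lerBrDr -!intrB (eq_floor_type_le _ dd').
by rewrite -!lerBlDr -!intrB (eq_floor_type_ge _ dd').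
Qed.

Lemma floor_type_int d m : floor_type d = (m, false) <-> d = m%:~R.
Proof.
split=> [dm|->].
  by apply/le_anti; rewrite floor_type_le floor_type_ge dm addr0 lexx.
by rewrite /floor_type intrKfloor intr_int.
Qed.

Lemma floor_type_nonint d m :
  floor_type d = (m, true) <-> m%:~R < d < m%:~R + 1.
Proof.
rewrite -intrD1; split=> [dm|/andP[md dm]].
  by rewrite !ltNge floor_type_le floor_type_ge dm /= addrC; lia.
have fE : Num.floor d = m by apply: floor_def; rewrite (ltW md).
by rewrite /floor_type fE intrEfloor fE lt_eqF.
Qed.

End FloorType.

(** * The amplitude M *)

Section Amplitude.
Context {R : realType} {n : nat} (a : 'I_n.+1 -> int).

Lemma le_amplitude i j : a i - a j <= amplitude a.
Proof. by apply: lerB; [apply: le_bigmax | apply: bigmin_le]. Qed.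

Lemma amplitude_ge0 : 0 <= amplitude a.
Proof. by rewrite -(subrr (a ord0)) le_amplitude. Qed.

Lemma le_amplitudeR i j : (a i)%:~R <= (a j)%:~R + (amplitude a)%:~R :> R.
Proof. by rewrite -intrD ler_int -lerBlDl le_amplitude. Qed.

Lemma amplitudeR_ge0 : 0 <= (amplitude a)%:~R :> R.
Proof. by rewrite ler0z amplitude_ge0. Qed.

Lemma intr_mul_amplitude k :
  (k%:Z * amplitude a)%:~R = k%:R * (amplitude a)%:~R :> R.
Proof. by rewrite intrM. Qed.

End Amplitude.

(** * Cells as sets of prescribed floor types; minimisers on a cell *)

Section Cells.
Context {R : realType} {n : nat} (a : 'I_n.+1 -> int).
Local Notation M := ((amplitude a)%:~R : R).
Implicit Types (v w : vdata n) (y : 'rV[R]_n).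

(** The clauses for e = 0 and e = 1 merge into one equation on floor types, so that facts about
    integer comparisons pass from one point of a cell to any other. *)
Lemma cellP v y : cell R a v y <->
  [/\ forall j, y 0 (vs v) <= y 0 j,
      forall r l, vpair v r l ->
        floor_type (y 0 r - y 0 l) = (vm v r l, ve v r l) &
      forall j, j \notin vB v -> y 0 (vs v) + j.+1%:R * M < y 0 j].
Proof.
split=> [[smin eq_m lt_m unb]|[smin ftE unb]]; split=> //.
- move=> r l vrl; case: (boolP (ve v r l)) => [e|ne].
    apply/floor_type_nonint; have := lt_m _ _ vrl e; lra.
  by apply/floor_type_int; rewrite (eq_m _ _ vrl ne); ring.
- by move=> j /unb; rewrite intr_mul_amplitude ltrBrDl.
- move=> r l vrl ne; have := ftE _ _ vrl; rewrite (negbTE ne).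
  by move/floor_type_int; lra.
- move=> r l vrl e; have := ftE _ _ vrl; rewrite e.
  by move/floor_type_nonint; lra.
- by move=> j /unb; rewrite intr_mul_amplitude ltrBrDl.
Qed.

Lemma vpair_floor_type v y y' :
  (forall r l, vpair v r l ->
     floor_type (y 0 r - y 0 l) = floor_type (y' 0 r - y' 0 l)) ->
  {in vB v &, forall r l,
     floor_type (y 0 r - y 0 l) = floor_type (y' 0 r - y' 0 l)}.
Proof.
move=> ftE r l rB lB; case: (ltngtP r l) => [rl|lr|/val_inj ->].
- by apply: ftE; rewrite /vpair rB lB.
- rewrite -opprB -[in RHS]opprB; apply: floor_typeN.
  by apply: ftE; rewrite /vpair rB lB.
- by rewrite !subrr.
Qed.

Lemma cell_floor_type v y y' : cell R a v y -> cell R a v y' ->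
  {in vB v &, forall r l,
     floor_type (y 0 r - y 0 l) = floor_type (y' 0 r - y' 0 l)}.
Proof.
move=> /cellP[_ yE _] /cellP[_ y'E _]; apply: vpair_floor_type => r l vrl.
by rewrite yE // y'E.
Qed.

Lemma argminP m (f : 'I_m -> R) i :
  reflect (forall j, f i <= f j) (i \in argmin f).
Proof. by rewrite inE; apply: forallP. Qed.

(** An unbounded coordinate exceeds the coordinate at [vs v] by more than M, which the coefficients
    cannot compensate. *)
Lemma argmin_bounded v y r : cell R a v y ->
  r \in argmin (fun i => y 0 i + (acoef a i)%:~R) -> r \in vB v.
Proof.
move=> /cellP[smin _ unb] /argminP /(_ (vs v)) rle.
apply/negPn/negP => /unb.
have := le_amplitudeR (R := R) a (widen_ord (leqnSn n) (vs v))
  (widen_ord (leqnSn n) r).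
have : 1 * M <= r.+1%:R * M by rewrite ler_wpM2r ?amplitudeR_ge0 // ler1n.
rewrite /acoef in rle *; lra.
Qed.

(** For bounded coordinates, comparing two sums y_r + a_r is comparing y_r - y_j with an integer, so
    the answer is constant on the cell; unbounded coordinates never win. *)
Lemma vSE v y : vs v \in vB v -> cell R a v y ->
  vS R a v = argmin (fun i => y 0 i + (acoef a i)%:~R).
Proof.
move=> sB cy; apply/setP => r; rewrite inE; apply/asboolP/idP; last by exists y.
case=> y' cy' rmin; have rB := argmin_bounded cy' rmin.
have le_bounded j : j \in vB v ->
    y 0 r + (acoef a r)%:~R <= y 0 j + (acoef a j)%:~R.
  move=> jB; have := argminP _ _ rmin j.
  have ftE := cell_floor_type cy cy' rB jB.
  have := eq_floor_type_le (acoef a j - acoef a r) ftE.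
  rewrite intrB lerBrDl addrCA addrA => h; move: h.
  by rewrite [in RHS]lerBrDl; lra.
apply/argminP => j; case: (boolP (j \in vB v)) => [|jB]; first exact: le_bounded.
have /cellP[smin _ unb] := cy.
have := unb _ jB; have := le_bounded _ sB.
have := le_amplitudeR (R := R) a (widen_ord (leqnSn n) (vs v))
  (widen_ord (leqnSn n) j).
have : 1 * M <= j.+1%:R * M by rewrite ler_wpM2r ?amplitudeR_ge0 // ler1n.
rewrite /acoef; lra.
Qed.

End Cells.

(** * One step of the recurrence *)

Section Coordinates.
Context {R : realType}.

Lemma coordE N (z : 'rV[R]_N) (i : 'I_N) : coord z i = z 0 i.
Proof. by rewrite /coord valK. Qed.

Lemma windowE n N (z : 'rV[R]_N) i (r : 'I_n) :
  window n z i 0 r = coord z (i + r).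
Proof. by rewrite mxE. Qed.

Lemma coord_window n N (z : 'rV[R]_N) i j :
  (j < n)%N -> coord (window n z i) j = coord z (i + j).
Proof. by move=> jn; rewrite -[j]/(val (Ordinal jn)) coordE windowE. Qed.

Lemma coord_snoc n (y : 'rV[R]_n) x j :
  (j < n)%N -> coord (snoc y x) j = coord y j.
Proof.
move=> jn; rewrite -[j in LHS]/(val (lshift 1 (Ordinal jn))) coordE.
by rewrite row_mxEl -coordE.
Qed.

Lemma coord_snoc_last n (y : 'rV[R]_n) x : coord (snoc y x) n = x.
Proof.
have := coordE (snoc y x) (rshift n (ord0 : 'I_1)).
by rewrite row_mxEr mxE /= addn0.
Qed.

Lemma slideE n (y : 'rV[R]_n) x (r : 'I_n) :
  (r.+1 < n)%N -> slide y x 0 r = coord y r.+1.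
Proof. by move=> rn; rewrite windowE add1n coord_snoc. Qed.

Lemma slide_last n (y : 'rV[R]_n) x (q : 'I_n) :
  q.+1 = n -> slide y x 0 q = x.
Proof. by move=> qn; rewrite windowE add1n qn coord_snoc_last. Qed.

Lemma slide_window n N (z : 'rV[R]_N) i :
  slide (window n z i) (coord z (i + n)) = window n z i.+1.
Proof.
apply/rowP => r; rewrite [RHS]windowE addSnnS.
have := ltn_ord r; rewrite leq_eqVlt => /orP[/eqP rn|rn].
  by rewrite slide_last // rn.
by rewrite slideE // coord_window.
Qed.

End Coordinates.

(** * Appending one term to a window *)

Section Satisfies.
Context {R : realType} {n : nat} (a : 'I_n.+1 -> int).
Local Notation M := ((amplitude a)%:~R : R).
Local Notation an := ((a ord_max)%:~R : R).
Implicit Types y : 'rV[R]_n.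

Lemma argmin_gt1P m (f : 'I_m -> R) : reflect
  (exists i j, [/\ i != j, forall k, f i <= f k & forall k, f j <= f k])
  (1 < #|argmin f|)%N.
Proof.
apply: (iffP card_gt1P) => [[i [j [/argminP fi /argminP fj ij]]]|[i [j []]]].
  by exists i, j.
by move=> ij /argminP fi /argminP fj; exists i, j.
Qed.

Lemma widen_or_max (i : 'I_n.+1) :
  i = ord_max \/ exists r : 'I_n, i = widen_ord (leqnSn n) r.
Proof.
case: (unliftP ord_max i) => [r ->|->]; [right|by left].
by exists r; apply: ord_inj; rewrite lift_max.
Qed.

Lemma coord_snoc_widen y x (r : 'I_n) :
  coord (snoc y x) (widen_ord (leqnSn n) r) = y 0 r.
Proof. by rewrite coord_snoc /= ?ltn_ord // coordE. Qed.

Lemma satisfies_snoc y x : satisfies a (snoc y x) <->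
  (1 < #|argmin (fun i : 'I_n.+1 => (coord (snoc y x) i + (a i)%:~R)%R)|)%N.
Proof.
split=> [sx|sx j jn]; first by apply: (sx 0%N); rewrite addn1.
by have -> : j = 0%N by lia.
Qed.

Lemma satisfies_window N (z : 'rV[R]_N) j : satisfies a z -> (j + n < N)%N ->
  satisfies a (snoc (window n z j) (coord z (j + n))).
Proof.
move=> sz jN; apply/satisfies_snoc; have := sz j jN.
congr (_ < #|argmin _|)%N; apply/funext => k; congr (_ + _).
case: (widen_or_max k) => [->|[r ->]]; first by rewrite coord_snoc_last.
by rewrite coord_snoc_widen windowE.
Qed.

(** Two old minimisers remain minimisers as long as the new term does not go below them. *)
Lemma satisfies_snoc_ge y x t :
  (1 < #|argmin (fun r => (y 0 r + (acoef a r)%:~R)%R)|)%N ->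
  t \in argmin (fun r => y 0 r + (acoef a r)%:~R) ->
  y 0 t + (acoef a t)%:~R <= x + an -> satisfies a (snoc y x).
Proof.
move=> /argmin_gt1P[i [j [ij imin jmin]]] /argminP tmin tx.
apply/satisfies_snoc/argmin_gt1P.
exists (widen_ord (leqnSn n) i), (widen_ord (leqnSn n) j); split=> // k;
  case: (widen_or_max k) => [->|[r ->]];
  rewrite !coord_snoc_widen ?imin ?jmin // coord_snoc_last.
  exact: le_trans (imin t) tx.
exact: le_trans (jmin t) tx.
Qed.

(** An old term minimal in the longer window is minimal among the old terms, hence is [t]. The
    second minimiser can then only be the new term, tied with [t]. *)
Lemma satisfies_snoc_uniq y x t :
  argmin (fun r => y 0 r + (acoef a r)%:~R) = [set t]%SET ->
  satisfies a (snoc y x) <-> x = y 0 t + (acoef a t)%:~R - an.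
Proof.
move=> tE; have tmin : t \in argmin (fun r => y 0 r + (acoef a r)%:~R).
  by rewrite tE set11.
have tuniq r : (forall k : 'I_n.+1, y 0 r + (acoef a r)%:~R <=
      coord (snoc y x) k + (a k)%:~R) -> r = t.
  move=> rmin; apply/set1P; rewrite -tE; apply/argminP => j.
  by have := rmin (widen_ord (leqnSn n) j); rewrite coord_snoc_widen.
move/argminP: (tmin) => {}tmin.
rewrite satisfies_snoc; split=> [/argmin_gt1P[i [j [ij]]]|xE].
  case: (widen_or_max i) => [iE|[r iE]]; case: (widen_or_max j) => [jE|[l jE]].
  - by rewrite iE jE eqxx in ij.
  - subst i j => /(_ (widen_ord (leqnSn n) l)) h1 lmin.
    have := lmin ord_max; rewrite coord_snoc_widen in h1 lmin *.
    rewrite coord_snoc_last in h1 *; have -> := tuniq _ lmin.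
    rewrite (tuniq _ lmin) /acoef in h1 *; lra.
  - subst i j => rmin /(_ (widen_ord (leqnSn n) r)) h1.
    have := rmin ord_max; rewrite coord_snoc_widen in h1 rmin *.
    rewrite coord_snoc_last in h1 *; have -> := tuniq _ rmin.
    rewrite (tuniq _ rmin) /acoef in h1 *; lra.
  - subst i j; rewrite !coord_snoc_widen => /tuniq rE /tuniq lE.
    by rewrite rE lE eqxx in ij.
apply/argmin_gt1P; exists (widen_ord (leqnSn n) t), ord_max; split.
- by rewrite -val_eqE /= ltn_eqF.
- move=> k; case: (widen_or_max k) => [->|[r ->]]; rewrite !coord_snoc_widen //.
  by rewrite coord_snoc_last /acoef in xE *; lra.
- move=> k; case: (widen_or_max k) => [->|[r ->]]; rewrite ?coord_snoc_widen //.
  by rewrite coord_snoc_last xE; have := tmin r; rewrite /acoef; lra.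
Qed.

(* One of the two minimizers is not the first term. *)
Lemma slide_min_le y x s : satisfies a (snoc y x) ->
  exists l, slide y x 0 l <= y 0 s + M.
Proof.
move/satisfies_snoc/argmin_gt1P => [i [j [ij imin jmin]]].
have [k k0 kmin] : exists2 k : 'I_n.+1, (0 < k)%N & forall l : 'I_n.+1,
    coord (snoc y x) k + (a k)%:~R <= coord (snoc y x) l + (a l)%:~R.
  have [i0|i0] := posnP i; last by exists i.
  exists j => //; rewrite lt0n; apply: contra ij => /eqP j0.
  by rewrite -val_eqE /= i0 j0.
have kn : (k.-1 < n)%N by rewrite -ltnS prednK.
exists (Ordinal kn); rewrite windowE /= add1n prednK //.
have := kmin (widen_ord (leqnSn n) s); rewrite coord_snoc_widen.
have := le_amplitudeR (R := R) a (widen_ord (leqnSn n) s) k; lra.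
Qed.

(* One of the two minimizers is not the last term. *)
Lemma satisfies_last_ge y x : satisfies a (snoc y x) ->
  exists2 t, t \in argmin (fun r => y 0 r + (acoef a r)%:~R) &
    y 0 t + (acoef a t)%:~R <= x + an.
Proof.
move/satisfies_snoc/argmin_gt1P => [i [j [ij imin jmin]]].
have [r rmin] : exists r : 'I_n, forall l : 'I_n.+1,
    y 0 r + (acoef a r)%:~R <= coord (snoc y x) l + (a l)%:~R.
  case: (widen_or_max i) => [iE|[r iE]]; last first.
    by exists r => l; rewrite /acoef -(coord_snoc_widen y x) -iE; apply: imin.
  case: (widen_or_max j) => [jE|[r jE]]; first by rewrite iE jE eqxx in ij.
  by exists r => l; rewrite /acoef -(coord_snoc_widen y x) -jE; apply: jmin.
exists r; last by have := rmin ord_max; rewrite coord_snoc_last.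
apply/argminP => l; have := rmin (widen_ord (leqnSn n) l).
by rewrite coord_snoc_widen.
Qed.

End Satisfies.

Section Bounded.
Context {n : nat}.
Implicit Types (B : {set 'I_n}) (r q : 'I_n).

Lemma mem_Bminus B r r' : r' = r.+1 :> nat -> (r \in Bminus B) = (r' \in B).
Proof.
move=> r'E; rewrite inE; apply/existsP/idP => [[l /andP[lB /eqP lE]]|r'B].
  by rewrite (_ : r' = l) //; apply: ord_inj; rewrite r'E lE.
by exists r'; rewrite r'B r'E /=.
Qed.

Lemma Bminus_succ B r : r \in Bminus B ->
  exists2 r', r' \in B & r' = r.+1 :> nat.
Proof. by rewrite inE => /existsP[l /andP[lB /eqP lE]]; exists l. Qed.

Lemma Bminus_lt B r : r \in Bminus B -> (r.+1 < n)%N.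
Proof. by case/Bminus_succ => r' _ <-. Qed.

Lemma mem_Bplus B r q : q.+1 = n ->
  (r \in Bplus B) = (r \in Bminus B) || (r == q).
Proof.
by move=> qn; rewrite finset.in_setU; congr (_ || _); rewrite inE -val_eqE /=; lia.
Qed.

End Bounded.

(** * Passing from one cell to the next *)

Section Edges.
Context {R : realType} {n : nat} (a : 'I_n.+1 -> int).
Local Notation M := ((amplitude a)%:~R : R).
Local Notation an := ((a ord_max)%:~R : R).
Implicit Types (v w : vdata n) (y : 'rV[R]_n) (r l q : 'I_n).

(** Here [y'] is any point of the target cell, unrelated to [y]: one known point of that cell
    controls the shifted coordinates of every point of the source cell. *)
Lemma edge_compat_floor_type v w y y' :
  edge_compat v w -> cell R a v y -> cell R a w y' ->
  {subset Bminus (vB v) <= vB w} ->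
  {in Bminus (vB v) &, forall r l : 'I_n,
     floor_type (coord y r.+1 - coord y l.+1) = floor_type (y' 0 r - y' 0 l)}.
Proof.
move=> vw /cellP[_ yE _] /cellP[_ y'E _] sub.
have ftE (r l : 'I_n) : r \in Bminus (vB v) -> l \in Bminus (vB v) -> (r < l)%N ->
    floor_type (coord y r.+1 - coord y l.+1) = floor_type (y' 0 r - y' 0 l).
  move=> rB lB rl; have [rw lw] := (sub _ rB, sub _ lB).
  have [r1 r1B r1E] := Bminus_succ rB; have [l1 l1B l1E] := Bminus_succ lB.
  have vrl : vpair v r1 l1 by rewrite /vpair r1B l1B r1E l1E.
  rewrite -r1E -l1E !coordE yE // y'E; last by rewrite /vpair rw lw.
  by have [-> ->] := vw _ _ _ _ vrl r1E l1E.
move=> r l rB lB; case: (ltngtP r l) => [|lr|/val_inj ->]; first exact: ftE.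
  by rewrite -opprB -[in RHS]opprB; apply: floor_typeN; apply: ftE.
by rewrite !subrr.
Qed.

(** Common criterion for the three kinds of edges: only the data of the new coordinate remain to be
    checked. Old floor types come from compatibility, minimality of [vs w] is transported from a
    point of the target cell, and old unbounded coordinates stay unbounded because their threshold
    drops by one M at each shift. *)
Lemma cell_slide v w y x q : q.+1 = n ->
  is_vertex R a w -> edge_compat v w ->
  vB w = Bminus (vB v) \/ vB w = Bplus (vB v) ->
  cell R a v y -> satisfies a (snoc y x) ->
  (q \in vB w -> forall r, r \in Bminus (vB v) ->
     floor_type (coord y r.+1 - x) = (vm w r q, ve w r q)) ->
  (q \notin vB w -> slide y x 0 (vs w) + n%:R * M < x) ->
  cell R a w (slide y x).
Proof.
move=> qn [sw _ [y' cy'] sw_min _] vw Bw cy sx Hq Hnq.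
have M0 := amplitudeR_ge0 (R := R) a.
have sub : {subset Bminus (vB v) <= vB w}.
  by move=> r rB; case: Bw => ->; rewrite // (mem_Bplus _ _ qn) rB.
have inBw r : r \in vB w -> r \in Bminus (vB v) \/ r = q.
  case: Bw => ->; first by left.
  by rewrite (mem_Bplus _ _ qn) => /orP[|/eqP]; [left|right].
have slideB r : r \in Bminus (vB v) -> slide y x 0 r = coord y r.+1.
  by move=> /Bminus_lt; apply: slideE.
have ftE r l : vpair w r l ->
    floor_type (slide y x 0 r - slide y x 0 l) = (vm w r l, ve w r l).
  move=> wrl; have /and3P[rw lw rl] := wrl.
  have [rB|rq] := inBw _ rw; last first.
    by have := ltn_ord l; rewrite rq in rl; lia.
  have [lB|lq] := inBw _ lw; last first.
    by subst l; rewrite slideB // (slide_last _ _ qn) Hq.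
  rewrite !slideB // (edge_compat_floor_type vw cy cy') //.
  by have /cellP[_ -> ] := cy'.
have sminB l : l \in vB w -> slide y x 0 (vs w) <= slide y x 0 l.
  move=> lw; have [_ /(_ l lw) y's _] := sw_min _ cy'.
  have ft : floor_type (slide y x 0 (vs w) - slide y x 0 l) =
      floor_type (y' 0 (vs w) - y' 0 l).
    apply: (vpair_floor_type (v := w)) => // r k wrk; rewrite ftE //.
    by have /cellP[_ -> ] := cy'.
  by have := eq_floor_type_le 0 ft; rewrite mulr0z !subr_le0 y's.
(* Index [l] was index [l.+1] before the shift, hence the factor [l.+2]; the extra M absorbs a
   possible rise of the minimum. *)
have unbE l : l \notin vB w -> l != q ->
    y 0 (vs v) + l.+2%:R * M < slide y x 0 l.
  move=> lw lq; have ln : (l.+1 < n)%N.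
    have := ltn_ord l; rewrite leq_eqVlt => /orP[/eqP ln|//].
    by case/eqP: lq; apply: ord_inj; apply: succn_inj; rewrite ln.
  rewrite slideE // (coordE _ (Ordinal ln)).
  have /cellP[_ _ /(_ (Ordinal ln))] := cy; apply.
  by apply: contra lw => lB; apply: sub; rewrite (@mem_Bminus _ _ _ (Ordinal ln)).
(* The recurrence lets the minimum of the window rise by at most M. *)
have sle : slide y x 0 (vs w) <= y 0 (vs v) + M.
  have [l lmin] := slide_min_le (vs v) sx.
  case: (boolP (l \in vB w)) => [/sminB sl|lw]; first exact: le_trans sl lmin.
  case: (eqVneq l q) => [lq|/(unbE _ lw) ll].
    subst l; apply: le_trans lmin; rewrite (slide_last _ _ qn).
    by apply: le_trans (ltW (Hnq lw)); rewrite lerDl mulr_ge0.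
  have : 1 * M <= l.+2%:R * M by rewrite ler_wpM2r // ler1n.
  lra.
apply/cellP; split=> //.
- move=> l; case: (boolP (l \in vB w)) => [/sminB //|lw].
  case: (eqVneq l q) => [lq|/(unbE _ lw) ll].
    subst l; rewrite (slide_last _ _ qn); apply: le_trans (ltW (Hnq lw)).
    by rewrite lerDl mulr_ge0.
  apply: le_trans sle (le_trans _ (ltW ll)).
  by rewrite lerD2l -[leLHS]mul1r ler_wpM2r // ler1n.
- move=> l lw; case: (eqVneq l q) => [lq|/(unbE _ lw) ll].
    by subst l; rewrite (slide_last _ _ qn) qn; apply: Hnq.
  by apply: le_lt_trans ll; rewrite -[l.+2%:R]natr1 mulrDl mul1r; lra.
Qed.
End Edges.

(** * Every edge is rigid or open *)

Section Steps.
Context {R : realType} {n : nat} (a : 'I_n.+1 -> int).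
Local Notation M := ((amplitude a)%:~R : R).
Local Notation an := ((a ord_max)%:~R : R).
Implicit Types (v w : vdata n) (y : 'rV[R]_n) (r l q t s : 'I_n).

(** The index and the constant serve all points of the cell at once, which makes the extension an
    affine map. *)
Definition rigid_step v w : Prop :=
  exists (r : 'I_n) (c : R),
    forall y, cell R a v y -> extensions a w y = [set y 0 r + c].

(** By the last clause the next cell alone forces the recurrence; this is what later allows a path
    polyhedron to be described by linear conditions. *)
Definition open_step v w : Prop :=
  forall y, cell R a v y ->
    [/\ extensions a w y !=set0, is_interval (extensions a w y),
        open (extensions a w y) &
        forall x, cell R a w (slide y x) -> satisfies a (snoc y x)].

Lemma exists_last q0 : exists q : 'I_n, q.+1 = n.
Proof.
have n0 : (0 < n)%N by apply: leq_ltn_trans (ltn_ord q0).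
have qn : (n.-1 < n)%N by rewrite prednK.
by exists (Ordinal qn); rewrite /= prednK.
Qed.

Lemma edge1_rigid v w : is_vertex R a v -> is_vertex R a w ->
  edge_compat v w -> edge1 R a v w -> rigid_step v w.
Proof.
move=> [sB _ _ _ _] vxw vw [t [y0 [x0 [tE [cy0 x0E] Bw data _]]]].
have [q qn] := exists_last t.
have minE y : cell R a v y ->
    argmin (fun i => y 0 i + (acoef a i)%:~R) = [set t]%SET.
  by move=> cy; rewrite -(vSE sB cy).
have tB : t \in vB v by apply: (argmin_bounded cy0); rewrite minE // set11.
exists t, ((acoef a t)%:~R - an) => y cy; rewrite addrA.
apply/seteqP; split=> x /=; first by case=> /(satisfies_snoc_uniq _ (minE _ cy)).
move=> xE; have sx := (satisfies_snoc_uniq x (minE _ cy)).2 xE.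
split=> //; apply: (cell_slide qn vxw vw _ cy sx); first by right.
  move=> _ r rB; have [r1 r1B r1E] := Bminus_succ rB.
  have [-> ->] := data r q rB qn; rewrite -/(floor_type _) x0E.
  rewrite slideE ?(Bminus_lt rB) // (slide_last _ _ qn) -r1E !coordE xE.
  (* The data of [w] were recorded at the single point [y0]. The difference with the new term is an
     integer shift of the difference with the bounded coordinate [t], so its floor type is the same
     at [y]. *)
  have := floor_typeDz (a ord_max - acoef a t) (cell_floor_type cy cy0 r1B tB).
  by rewrite intrB => e; apply: etrans (etrans e _); congr floor_type; ring.
by rewrite Bw (mem_Bplus _ _ qn) eqxx orbT.
Qed.

(** The extensions form the open ray above the new minimum plus nM. Such a term lies above the old
    minimum even after adding coefficients, since nM is at least M, so the two old minimisers
    persist. *)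
Lemma edge2_open v w : is_vertex R a v -> is_vertex R a w ->
  edge_compat v w -> edge2 R a v w -> open_step v w.
Proof.
move=> [sB _ _ _ _] vxw vw [S2 Bw _] y cy.
have [sw _ _ _ _] := vxw; have [q qn] := exists_last (vs w).
have swB : vs w \in Bminus (vB v) by rewrite -Bw.
have [s1 s1B s1E] := Bminus_succ swB.
have qw : q \notin vB w.
  by rewrite Bw; apply/negP => /Bminus_lt; rewrite qn ltnn.
have slide_s x : slide y x 0 (vs w) = y 0 s1.
  by rewrite slideE ?(Bminus_lt swB) // -s1E coordE.
rewrite (vSE sB cy) in S2; have M0 := amplitudeR_ge0 (R := R) a.
have n1 : 1 <= n%:R :> R by rewrite -qn ler1n.
have sat x : y 0 s1 + n%:R * M < x -> satisfies a (snoc y x).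
  move=> sx; have /card_gt1P[t [_ [tmin _ _]]] := S2.
  apply: (satisfies_snoc_ge S2 tmin); have := argminP _ _ tmin s1.
  have := le_amplitudeR (R := R) a (widen_ord (leqnSn n) s1) ord_max.
  have : 1 * M <= n%:R * M by rewrite ler_wpM2r.
  rewrite /acoef; lra.
have cellE x : cell R a w (slide y x) <-> y 0 s1 + n%:R * M < x.
  split=> [/cellP[_ _ /(_ _ qw)]|sx].
    by rewrite slide_s (slide_last _ _ qn) qn.
  apply: (cell_slide qn vxw vw _ cy (sat _ sx)); first by left.
    by rewrite (negbTE qw).
  by rewrite slide_s.
have extE : extensions a w y = [set` `]y 0 s1 + n%:R * M, +oo[ ].
  apply/seteqP; split=> x; rewrite /= in_itv /= andbT.
    by case=> _ /cellE.
  by move=> sx; split; [apply: sat | apply/cellE].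
split.
- exists (y 0 s1 + n%:R * M + 1); rewrite extE /= in_itv /= andbT; lra.
- by rewrite extE; apply: interval_is_interval.
- by rewrite extE; apply: interval_open.
- by move=> x /cellE/sat.
Qed.

(** The bound on m(t-1,n) says that the new term does not go below the minimum, so only the floor
    types of its differences with bounded coordinates constrain it. One integral difference
    determines it; otherwise each difference leaves an open unit interval, and the intersection of
    these is nonempty. *)
Lemma edge3_step v w : is_vertex R a v -> is_vertex R a w ->
  edge_compat v w -> edge3 R a v w -> rigid_step v w \/ open_step v w.
Proof.
move=> [sB _ _ _ _] vxw vw.
move=> [S2 [t [t1 [s' [q [[[tS t0 _] tE] [_ qn] Bw mt _]]]]]].
have [_ _ [y' cy'] _ _] := vxw.
have qw : q \in vB w by rewrite Bw (mem_Bplus _ _ qn) eqxx orbT.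
have sub : {subset Bminus (vB v) <= vB w}.
  by move=> r rB; rewrite Bw (mem_Bplus _ _ qn) rB.
have lt_q r : r \in Bminus (vB v) -> (r < q)%N.
  by move/Bminus_lt; rewrite -[n in (_ < n)%N]qn ltnS.
have y'E r : r \in Bminus (vB v) ->
    floor_type (y' 0 r - y' 0 q) = (vm w r q, ve w r q).
  move=> rB; have /cellP[_ -> //] := cy'.
  by rewrite /vpair qw sub // lt_q.
have tB y : cell R a v y -> t \in vB v.
  by move=> cy; apply: (argmin_bounded cy); rewrite -(vSE sB cy).
have sat y x : cell R a v y ->
    floor_type (y 0 t - x) = (vm w t1 q, ve w t1 q) -> satisfies a (snoc y x).
  move=> cy ftE; move: S2 tS; rewrite !(vSE sB cy) => S2 tS.
  apply: (satisfies_snoc_ge S2 tS).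
  have : y 0 t - x <= (a ord_max - acoef a t)%:~R.
    by rewrite floor_type_le ftE; move: mt; case: (ve w t1 q) => /=; lia.
  by rewrite intrB; lra.
have t1B y : cell R a v y -> t1 \in Bminus (vB v).
  by move=> cy; rewrite (mem_Bminus _ tE) (tB _ cy).
have extE y : cell R a v y -> extensions a w y = [set x | forall r,
    r \in Bminus (vB v) -> floor_type (coord y r.+1 - x) = (vm w r q, ve w r q)].
  move=> cy; apply/seteqP; split=> x /=.
    case=> _ /cellP[_ ftE _] r rB; rewrite -ftE; last first.
      by rewrite /vpair qw sub // lt_q.
    by rewrite slideE ?(Bminus_lt rB) // (slide_last _ _ qn).
  move=> ftE; have sx : satisfies a (snoc y x).
    by apply: sat => //; rewrite -ftE ?(t1B y) // -tE coordE.
  split=> //; apply: (cell_slide qn vxw vw _ cy sx) => //; first by right.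
  by rewrite qw.
have cell_sat y x : cell R a v y -> cell R a w (slide y x) ->
    satisfies a (snoc y x).
  move=> cy /cellP[_ ftE _]; apply: sat => //; rewrite -ftE; last first.
    by rewrite /vpair qw sub ?(t1B y) // lt_q ?(t1B y).
  by rewrite slideE ?(Bminus_lt (t1B y cy)) // (slide_last _ _ qn) -tE coordE.
case: (boolP [exists r in Bminus (vB v), ~~ ve w r q]) => [/existsP[r0]|no].
  case/andP=> r0B /negbTE e0; left; have [r1 r1B r1E] := Bminus_succ r0B.
  exists r1, (- (vm w r0 q)%:~R) => y cy; rewrite extE //.
  apply/seteqP; split=> x /= xE.
    have := xE _ r0B; rewrite e0 => /floor_type_int.
    by rewrite -r1E coordE => <-; ring.
  (* The remaining constraints are integer shifts of old differences, and they hold at the point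
     [y'] of the target cell. *)
  move=> r rB; rewrite -y'E //.
  have := y'E _ r0B; rewrite e0 => /floor_type_int y'0.
  have := floor_typeDz (vm w r0 q) (edge_compat_floor_type vw cy cy' sub rB r0B).
  rewrite xE -r1E coordE -y'0.
  by move=> e; apply: etrans (etrans e _); congr floor_type; lra.
have e1 r : r \in Bminus (vB v) -> ve w r q.
  by move=> rB; apply: contraNT no => e; apply/existsP; exists r; rewrite rB.
(* The constraint from [r] is the interval from [U r - 1] to [U r]; the smallest and the largest [U]
   give the intersection. *)
right=> y cy; pose U r := coord y r.+1 - (vm w r q)%:~R.
case: (arg_minP U (t1B y cy)) => r1 r1B U1.
case: (arg_maxP U (t1B y cy)) => r2 r2B U2.
(* The overlap of two such intervals is a comparison of old coordinates with an integer; it holds at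
   [y'], whose last coordinate lies in both intervals. *)
have U21 : U r2 - 1 < U r1.
  have := y'E _ r1B; rewrite e1 // => /floor_type_nonint y'1.
  have := y'E _ r2B; rewrite e1 // => /floor_type_nonint y'2.
  have := eq_floor_type_ge (vm w r2 q - vm w r1 q + 1)
    (edge_compat_floor_type vw cy cy' sub r2B r1B).
  rewrite intrD intrB /U => h; rewrite ltNge; apply/negP => h2.
  have : (vm w r2 q)%:~R - (vm w r1 q)%:~R + 1 <= coord y r2.+1 - coord y r1.+1
    by lra.
  rewrite h; lra.
have extI : extensions a w y = [set` `]U r2 - 1, U r1[ ].
  rewrite extE //; apply/seteqP; split=> x /= xE.
    rewrite in_itv /=.
    have := xE _ r1B; rewrite e1 // => /floor_type_nonint.
    have := xE _ r2B; rewrite e1 // => /floor_type_nonint.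
    rewrite /U; lra.
  move=> r rB; rewrite e1 //; apply/floor_type_nonint.
  have h1 : U r1 <= U r by apply: U1.
  have h2 : U r <= U r2 by apply: U2.
  move: xE h1 h2; rewrite in_itv /U /=; lra.
split.
- exists ((U r2 - 1 + U r1) / 2); rewrite extI /= in_itv /=; lra.
- by rewrite extI; apply: interval_is_interval.
- by rewrite extI; apply: interval_open.
- by move=> x; apply: cell_sat.
Qed.

Lemma edge_step v w : edge R a v w -> rigid_step v w \/ open_step v w.
Proof.
case=> vv ww vw [] e; first by left; apply: edge1_rigid.
  by right; apply: edge2_open.
exact: edge3_step.
Qed.

(** At every point of the cell the extensions form a singleton, which is not open. *)
Lemma rigid_not_augmenting v w : rigid_step v w -> ~ augmenting R a v w.
Proof.
move=> [r [c extE]] [y cy [_ _]]; rewrite extE // => op.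
have /(_ (y 0 r + c) erefl) := op.
move=> /nbhs_ballP[e /= e0 sub].
have : ball (y 0 r + c) e (y 0 r + c + e / 2).
  by rewrite /ball /= opprD addrA subrr add0r normrN gtr0_norm ?divr_gt0 //; lra.
by move/sub => /= ; lra.
Qed.

Lemma open_augmenting v w : is_vertex R a v -> open_step v w ->
  augmenting R a v w.
Proof. by move=> [_ _ [y cy] _ _] /(_ y cy)[]; exists y. Qed.

End Steps.

(** * Dimension *)

Section AffineHull.
Context {R : realType} {N : nat}.
Implicit Types (A : set 'rV[R]_N) (x p q : 'rV[R]_N).

Lemma affine_hull_combination A (I : finType) (p : I -> 'rV[R]_N) (c : I -> R) :
  (forall i, A (p i)) -> \sum_i c i = 1 ->
  affine_hull A (\sum_i c i *: p i).
Proof.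
move=> Ap c1; exists #|I|, (p \o enum_val), (c \o enum_val); split=> //.
- by move=> i; apply: Ap.
- by rewrite -c1 [RHS]big_enum_val.
- by rewrite [LHS]big_enum_val.
Qed.

Lemma sub_affine_hull A : A `<=` affine_hull A.
Proof.
by move=> x Ax; exists 1%N, (fun=> x), (fun=> 1); rewrite !big_ord1 scale1r.
Qed.

Lemma affine_hull_line A x p q c : affine_hull A x -> A p -> A q ->
  affine_hull A (x + c *: (p - q)).
Proof.
move=> [h [r [d [Ar d1 ->]]]] Ap Aq.
pose p' (i : 'I_h + bool) := match i with
  | inl j => r j | inr true => p | inr false => q end.
pose d' (i : 'I_h + bool) := match i with
  | inl j => d j | inr true => c | inr false => - c end.
have := @affine_hull_combination A _ p' d'.
rewrite !big_sumType !big_bool /= d1 subrr addr0 scalerBr scaleNr.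
by apply=> // -[//|[]].
Qed.

Lemma affine_hull_sub A x0 (U : {vspace 'rV[R]_N}) :
  (forall x, A x -> x - x0 \in U) -> forall x, affine_hull A x -> x - x0 \in U.
Proof.
move=> AU x [h [p [c [Ap c1 ->]]]].
have -> : \sum_i c i *: p i - x0 = \sum_i c i *: (p i - x0).
  rewrite -[in LHS](scale1r x0) -c1 scaler_suml -sumrB.
  by apply: eq_bigr => i _; rewrite scalerBr.
by apply: memv_suml => i _; apply/memvZ/AU.
Qed.

(** The base point can be taken in the set itself. Dimension then splits into two inclusions: the
    set lies in the affine space, and the affine space lies in the hull. *)
Lemma has_dimP A d : has_dim A d <-> exists x0 (U : {vspace 'rV[R]_N}),
  [/\ A x0, \dim U = d, forall x, A x -> x - x0 \in U &
      forall u, u \in U -> affine_hull A (x0 + u)].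
Proof.
split=> [[x0 [U [hE dU]]]|[x0 [U [Ax0 dU AU UA]]]]; last first.
  exists x0, U; split=> //; apply/seteqP; split=> x /=.
    exact: affine_hull_sub.
  by move/UA; rewrite addrC subrK.
have : affine_hull A x0 by rewrite hE /= subrr mem0v.
case=> h [p [c [Ap c1 _]]].
(* The weights sum to 1, so the combination is not empty and provides a point of [A]. *)
have [i _] : exists i : 'I_h, True.
  case: h p c Ap c1 => [p c _|h p c _ _]; last by exists ord0.
  by rewrite big_ord0 => /esym/eqP; rewrite oner_eq0.
have AU x : A x -> x - x0 \in U.
  by move/sub_affine_hull; rewrite hE.
exists (p i), U; split=> //.
  move=> x Ax; rewrite -[x](subrK x0) -addrA -[x0 - _]opprB.
  by rewrite rpredB // AU.
by move=> u uU; rewrite hE /= addrAC rpredD // AU.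
Qed.

End AffineHull.

(** * Dimension after adding one coordinate *)

Section Extension.
Context {R : realType} {N : nat}.
Implicit Types (x : 'rV[R]_N) (z : 'rV[R]_N.+1) (t : R).

(** The last coordinate is split off on the type [N.+1], to which [k.+1 + n] reduces by computation
    with [N] equal to [k + n]. *)
Definition trunc z : 'rV[R]_N := \row_i z 0 (widen_ord (leqnSn N) i).

Definition extend x t : 'rV[R]_N.+1 :=
  \row_(i < N.+1) (if (i < N)%N then coord x i else t).

Lemma extend_widen x t i : extend x t 0 (widen_ord (leqnSn N) i) = x 0 i.
Proof. by rewrite mxE /= ltn_ord coordE. Qed.

Lemma extend_max x t : extend x t 0 ord_max = t.
Proof. by rewrite mxE /= ltnn. Qed.

Lemma eq_extend z z' : (forall i : 'I_N, z 0 (widen_ord (leqnSn N) i) =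
    z' 0 (widen_ord (leqnSn N) i)) -> z 0 ord_max = z' 0 ord_max -> z = z'.
Proof.
by move=> h1 h2; apply/rowP => i; case: (widen_or_max i) => [->|[r ->]].
Qed.

Lemma extendK x t : trunc (extend x t) = x.
Proof. by apply/rowP => i; rewrite mxE extend_widen. Qed.

Lemma trunc_extend z : extend (trunc z) (z 0 ord_max) = z.
Proof.
by apply: eq_extend => [i|]; rewrite ?extend_widen ?extend_max // mxE.
Qed.

Lemma extend_inj x x' t t' : extend x t = extend x' t' -> x = x' /\ t = t'.
Proof.
move=> e; split; first by rewrite -(extendK x t) e extendK.
by rewrite -(extend_max x t) e extend_max.
Qed.

Lemma extendD x x' t t' : extend (x + x') (t + t') = extend x t + extend x' t'.
Proof. by apply: eq_extend => [i|]; rewrite [RHS]mxE !(extend_widen, extend_max) ?mxE. Qed.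

Lemma extendZ c x t : extend (c *: x) (c * t) = c *: extend x t.
Proof. by apply: eq_extend => [i|]; rewrite [RHS]mxE !(extend_widen, extend_max) ?mxE. Qed.

Lemma extendB x x' t t' : extend (x - x') (t - t') = extend x t - extend x' t'.
Proof.
by rewrite -[- extend _ _]scaleN1r -extendZ -extendD scaleN1r mulN1r.
Qed.

Lemma extend_sum h (p : 'I_h -> 'rV[R]_N) (c t : 'I_h -> R) :
  extend (\sum_i c i *: p i) (\sum_i c i * t i) =
  \sum_i c i *: extend (p i) (t i).
Proof.
apply: eq_extend => [i|]; rewrite ?extend_widen ?extend_max !summxE;
  apply: eq_bigr => j _; rewrite !mxE /= ?ltn_ord ?ltnn ?coordE //.
Qed.

(** Linear part of the two ways of extending: repeat coordinate [i], or append zero for [None]. *)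
Definition extend_with (i : option 'I_N) x : 'rV[R]_N.+1 :=
  extend x (oapp (x 0) 0 i).

Lemma extend_with_is_linear i : linear (extend_with i).
Proof.
move=> c x y; rewrite /extend_with -extendZ -extendD.
by case: i => [i|] /=; rewrite ?mulr0 ?addr0 ?mxE.
Qed.

HB.instance Definition _ i := GRing.isLinear.Build R 'rV[R]_N 'rV[R]_N.+1
  *:%R (extend_with i) (extend_with_is_linear i).

Lemma dim_extend_with i (U : {vspace 'rV[R]_N}) :
  \dim (linfun (extend_with i) @: U) = \dim U.
Proof.
apply: limg_dim_eq; apply/eqP; rewrite -subv0; apply/subvP => u.
rewrite memv_cap memv_ker lfunE /= memv0 => /andP[_ /eqP e].
have : extend_with i u = extend 0 0.
  by rewrite e -[0 in RHS](scale0r 0) -[X in extend _ X](mul0r 0) extendZ scale0r.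
by case/extend_inj => ->.
Qed.

(** The new set is the graph of an affine function over [A], so its direction space is an injective
    linear image of the old one. *)
Lemma has_dim_rigid (A : set 'rV[R]_N) d (i : 'I_N) c : has_dim A d ->
  has_dim [set z | A (trunc z) /\ z 0 ord_max = trunc z 0 i + c] d.
Proof.
move=> /has_dimP[x0 [U [Ax0 dU AU UA]]]; apply/has_dimP.
exists (extend x0 (x0 0 i + c)), (linfun (extend_with (Some i)) @: U)%VS; split.
- by rewrite /= extendK extend_max.
- by rewrite dim_extend_with.
- move=> z [Az zE]; apply/memv_imgP; exists (trunc z - x0); first exact: AU.
  rewrite lfunE -[z in LHS]trunc_extend -extendB /= /extend_with /=.
  by congr extend; rewrite zE !mxE; ring.
- move=> _ /memv_imgP[u /UA[h [p [e [Ap e1 uE]]]] ->]; rewrite lfunE /=.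
  rewrite /extend_with -extendD /= uE.
  (* The constant [c] passes through the combination because the weights sum to 1. *)
  have -> : x0 0 i + c + u 0 i = \sum_j e j * (p j 0 i + c).
    under eq_bigr do rewrite mulrDr.
    rewrite big_split /= -mulr_suml e1 mul1r addrAC; congr (_ + _).
    have -> : x0 0 i + u 0 i = (x0 + u) 0 i by rewrite mxE.
    by rewrite uE summxE; apply: eq_bigr => j _; rewrite mxE.
  rewrite extend_sum; apply: affine_hull_combination => // j.
  by rewrite /= extendK extend_max.
Qed.

(** Nonempty fibres let every affine combination in [A] be lifted; two distinct values over the base
    point add the vertical direction [e], independent of the lifted directions. *)
Lemma has_dim_open (A : set 'rV[R]_N) d (X : 'rV[R]_N -> set R) : has_dim A d ->
  (forall x, A x -> exists t1 t2, [/\ X x t1, X x t2 & t1 != t2]) ->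
  has_dim [set z | A (trunc z) /\ X (trunc z) (z 0 ord_max)] d.+1.
Proof.
move=> /has_dimP[x0 [U [Ax0 dU AU UA]]] AX; apply/has_dimP.
have [t1 [t2 [Xt1 Xt2 t12]]] := AX _ Ax0.
pose e := extend (0 : 'rV[R]_N) 1.
exists (extend x0 t1), (linfun (extend_with None) @: U + <[e]>)%VS; split.
- by rewrite /= extendK extend_max.
- rewrite dimv_disjoint_sum ?dim_extend_with ?dim_vline ?dU; last first.
    apply/eqP; rewrite -subv0; apply/subvP => w; rewrite memv_cap memv0.
    case/andP=> /memv_imgP[u _ ->] /vlineP[k]; rewrite lfunE /=.
    rewrite -extendZ => /extend_inj[uE _]; rewrite uE scaler0.
    by rewrite linear0.
  suff -> : e != 0 by rewrite addn1.
  apply/eqP => e0; have := extend_max (0 : 'rV[R]_N) 1.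
  by rewrite -/e e0 mxE => /eqP; rewrite eq_sym oner_eq0.
- move=> z [Az _]; apply/memv_addP.
  exists (extend_with None (trunc z - x0)).
    by apply/memv_imgP; exists (trunc z - x0); [apply: AU | rewrite lfunE].
  exists ((z 0 ord_max - t1) *: e); first exact/memvZ/memv_line.
  rewrite -[z in LHS]trunc_extend -extendB /extend_with /= -extendZ -extendD.
  by rewrite scaler0 addr0 add0r mulr1.
- move=> _ /memv_addP[_ /memv_imgP[u uU ->] [_ /vlineP[k ->] ->]].
  have [h [p [c [Ap c1 uE]]]] := UA _ uU.
  have /choice[s sX] : forall j, exists s, X (p j) s.
    by move=> j; have [s [_ [Xs _ _]]] := AX _ (Ap j); exists s.
  have hs : affine_hull [set z | A (trunc z) /\ X (trunc z) (z 0 ord_max)]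
      (extend (x0 + u) (\sum_j c j * s j)).
    rewrite uE extend_sum; apply: affine_hull_combination => // j.
    by rewrite /= extendK extend_max.
  (* Multiple of the vertical difference that corrects the last coordinate of the lifted combination
     to [t1 + k]. *)
  pose b := (t1 + k - \sum_j c j * s j) / (t1 - t2).
  have t0 : t1 - t2 != 0 by rewrite subr_eq0.
  have := @affine_hull_line _ _ _ _ (extend x0 t1) (extend x0 t2) b hs.
  rewrite /= !extendK !extend_max => /(_ (conj Ax0 Xt1) (conj Ax0 Xt2)).
  congr (affine_hull _ _); rewrite lfunE /= /extend_with -extendB -!extendZ.
  rewrite -!extendD /=; congr extend; first by rewrite subrr !scaler0 !addr0.
  by rewrite /b divfK //; ring.
Qed.

End Extension.

(** * The dimension of a cell is its number of classes *)

Section CellDimension.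
Context {R : realType} {n : nat} (a : 'I_n.+1 -> int).
Local Notation M := ((amplitude a)%:~R : R).
Implicit Types (v : vdata n) (y : 'rV[R]_n) (r l : 'I_n).

Lemma vequiv_int v y : cell R a v y -> {in vB v &, forall r l,
  vequiv v r l = (y 0 r - y 0 l \is a Num.int)}.
Proof.
move=> /cellP[_ yE _] r l rB lB; rewrite /vequiv -val_eqE.
case: (ltngtP r l) => [rl|lr|/val_inj ->] /=; last by rewrite subrr rpred0.
  have /yE : vpair v r l by rewrite /vpair rB lB.
  by rewrite orbF => -[_ <-]; rewrite negbK.
have /yE : vpair v l r by rewrite /vpair rB lB.
by case=> _ <-; rewrite negbK -rpredN opprB.
Qed.

(** Treats bounded and unbounded coordinates uniformly: the distinct values are exactly the classes
    counted by [nclasses]. *)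
Definition coord_class v r : {set 'I_n} :=
  if r \in vB v then [set l in vB v | vequiv v r l]%SET else [set r]%SET.

Lemma mem_coord_class v r : r \in coord_class v r.
Proof. by rewrite /coord_class; case: ifP => rB; rewrite !inE ?rB /vequiv eqxx. Qed.

Lemma coord_class_inv v r l : coord_class v r = coord_class v l ->
  r = l \/ [/\ r \in vB v, l \in vB v & vequiv v r l].
Proof.
move=> rl; have : l \in coord_class v r by rewrite rl mem_coord_class.
rewrite {1}/coord_class; case: ifP => rB; rewrite !inE.
  by case/andP; right.
by move/eqP; left.
Qed.

Lemma eq_coord_class v y r l : cell R a v y -> r \in vB v -> l \in vB v ->
  vequiv v r l -> coord_class v r = coord_class v l.
Proof.
move=> cy rB lB; rewrite (vequiv_int cy) // /coord_class rB lB => rl.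
apply/setP => k; rewrite !inE; case: (boolP (k \in vB v)) => //= kB.
rewrite !(vequiv_int cy) //.
have -> : y 0 r - y 0 k = y 0 r - y 0 l + (y 0 l - y 0 k) by lra.
exact: rpredDl.
Qed.

Lemma card_coord_class v :
  #|[set coord_class v r | r in [set: 'I_n]]%SET| = nclasses v.
Proof.
have -> : [set coord_class v r | r in [set: 'I_n]]%SET =
   (equivalence_partition (vequiv v) (vB v) :|: [set [set r] | r in ~: vB v])%SET.
  apply/setP => K; rewrite finset.in_setU; apply/imsetP/orP => [[r _ ->]|[]].
  - rewrite /coord_class; case: (boolP (r \in vB v)) => rB; [left|right].
      exact: imset_f.
    by apply: imset_f; rewrite finset.in_setC.
  - by case/imsetP=> r rB ->; exists r; rewrite // /coord_class rB.
  - case/imsetP=> r; rewrite finset.in_setC => rB ->.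
    by exists r; rewrite // /coord_class (negbTE rB).
(* The two families are disjoint: a class of a bounded coordinate contains that coordinate, whereas
   the singletons are those of unbounded ones. *)
rewrite cardsU [X in (_ - X)%N](_ : _ = 0%N) ?subn0.
  by rewrite card_imset //; apply: set1_inj.
apply/eqP; rewrite cards_eq0 -finset.subset0; apply/fintype.subsetP => K.
rewrite finset.in_setI => /andP[/imsetP[r rB ->] /imsetP[l]].
rewrite finset.in_setC => lB /setP/(_ r); rewrite !inE rB /vequiv eqxx /=.
by move/esym/eqP => rl; rewrite rl (negbTE lB) in rB.
Qed.

Lemma near0_pos (c b : R) : 0 < c -> \forall e \near (0 : R)^'+, 0 < c + e * b.
Proof.
move=> c0; have b1 : 0 < `|b| + 1 by rewrite ltr_wpDl.
near=> e; have e0 : 0 < e by near: e; apply: nbhs_right_gt.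
have : e < c / (`|b| + 1) by near: e; apply: nbhs_right_lt; rewrite divr_gt0.
rewrite ltr_pdivlMr // => ec.
have : - (e * `|b|) <= e * b.
  rewrite -mulrN; apply: ler_wpM2l; first exact: ltW.
  by rewrite lerNl -normrN ler_norm.
lra.
Unshelve. all: by end_near. Qed.

(** Moving along a direction constant on classes keeps the equalities, and finitely many strict
    inequalities survive a small step. Minimality at [vs v], a weak inequality, is recovered from
    the floor types and the unbounded gaps. *)
Lemma cell_near v y (u : 'rV[R]_n) : vs v \in vB v -> cell R a v y ->
  (forall r l, vpair v r l -> ~~ ve v r l -> u 0 r = u 0 l) ->
  \forall e \near (0 : R)^'+, cell R a v (y + e *: u).
Proof.
move=> sB cy uE; have /cellP[_ yE unb] := cy.
have pair_near : \forall e \near (0 : R)^'+, forall r l, vpair v r l -> ve v r l ->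
    (vm v r l)%:~R < (y + e *: u) 0 r - (y + e *: u) 0 l < (vm v r l)%:~R + 1.
  apply: filter_forall => r; apply: filter_forall => l.
  case: (boolP (vpair v r l && ve v r l)) => [/andP[vrl e1]|]; last first.
    by move=> no; near=> e => vrl e1; rewrite vrl e1 in no.
  have := yE _ _ vrl; rewrite e1 => /floor_type_nonint/andP[h1 h2].
  near=> e => _ _; rewrite !mxE.
  have : 0 < y 0 r - y 0 l - (vm v r l)%:~R + e * (u 0 r - u 0 l).
    by near: e; apply: near0_pos; lra.
  have : 0 < (vm v r l)%:~R + 1 - (y 0 r - y 0 l) + e * (u 0 l - u 0 r).
    by near: e; apply: near0_pos; lra.
  by rewrite !mulrBr => p1 p2; apply/andP; split; lra.
have unb_near : \forall e \near (0 : R)^'+, forall j, j \notin vB v ->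
    (y + e *: u) 0 (vs v) + j.+1%:R * M < (y + e *: u) 0 j.
  apply: filter_forall => j; case: (boolP (j \in vB v)) => [jB|jB].
    by near=> e.
  near=> e => _; rewrite !mxE.
  have : 0 < y 0 j - (y 0 (vs v) + j.+1%:R * M) + e * (u 0 j - u 0 (vs v)).
    by near: e; apply: near0_pos; rewrite subr_gt0 unb.
  by rewrite mulrBr; lra.
near=> e; have ftE r l : vpair v r l ->
    floor_type ((y + e *: u) 0 r - (y + e *: u) 0 l) = (vm v r l, ve v r l).
  move=> vrl; case: (boolP (ve v r l)) => [e1|e0].
    by apply/floor_type_nonint; move: r l vrl e1; near: e.
  have := yE _ _ vrl; rewrite (negbTE e0) => /floor_type_int h.
  by apply/floor_type_int; rewrite !mxE (uE _ _ vrl e0) -h; ring.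
have unbe j : j \notin vB v ->
    (y + e *: u) 0 (vs v) + j.+1%:R * M < (y + e *: u) 0 j.
  by move: j; near: e.
apply/cellP; split=> // j; case: (boolP (j \in vB v)) => [jB|/unbe jB].
  have /cellP[smin _ _] := cy.
  have ft : floor_type ((y + e *: u) 0 (vs v) - (y + e *: u) 0 j) =
      floor_type (y 0 (vs v) - y 0 j).
    by apply: (vpair_floor_type (v := v)) => // r l vrl; rewrite ftE // yE.
  by have := eq_floor_type_le 0 ft; rewrite mulr0z !subr_le0 smin.
apply: le_trans (ltW jB); rewrite lerDl mulr_ge0 //; exact: amplitudeR_ge0.
Unshelve. all: by end_near. Qed.

(** The directions are the vectors constant on classes. Two points of the cell differ by such a
    vector, since integral differences are fixed by the vertex; conversely a small multiple of each
    such vector stays in the cell. *)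
Lemma has_dim_cell v : is_vertex R a v -> has_dim (cell R a v) (nclasses v).
Proof.
move=> [sB _ [y cy] _ _]; rewrite -card_coord_class.
set K := [set coord_class v r | r in _]%SET.
have classK r : coord_class v r \in K by apply: imset_f.
pose idx r : 'I_#|K| := enum_rank_in (classK (vs v)) (coord_class v r).
have idxK r : enum_val (idx r) = coord_class v r by rewrite enum_rankK_in.
have idxP r l : idx r = idx l <-> coord_class v r = coord_class v l.
  by split=> [e|]; [rewrite -!idxK e | rewrite /idx => ->].
have /choice[rep repK] : forall k : 'I_#|K|, exists r, idx r = k.
  move=> k; have /imsetP[r _ rE] := enum_valP k.
  by exists r; apply: enum_val_inj; rewrite idxK rE.
pose h := linfun (mxsub id idx : 'rV[R]_#|K| -> 'rV[R]_n).
have hE u r : h u 0 r = u 0 (idx r) by rewrite lfunE /= mxE.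
apply/has_dimP; exists y, (limg h); split=> //.
- rewrite limg_dim_eq ?dimvf ?dim_matrix; first exact: mul1n.
  apply/eqP; rewrite -subv0; apply/subvP => u.
  rewrite memv_cap memv_ker memv0 => /andP[_ /eqP u0].
  apply/eqP/rowP => k; have := congr1 (fun w : 'rV[R]_n => w 0 (rep k)) u0.
  by rewrite /= hE repK !mxE.
- move=> x cx; apply/memv_imgP; exists (\row_k (x - y) 0 (rep k)); first exact: memvf.
  apply/rowP => r; rewrite hE [RHS]mxE; have := repK (idx r).
  move: (rep _) => l /idxP/coord_class_inv[->//|[lB rB]].
  rewrite (vequiv_int cx) // => xint; have := cell_floor_type cx cy lB rB.
  have xE : floor_type (x 0 l - x 0 r) = (Num.floor (x 0 l - x 0 r), false).
    by rewrite /floor_type xint.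
  rewrite xE => /esym/floor_type_int yE; move/floor_type_int: xE.
  by rewrite !mxE; lra.
- move=> _ /memv_imgP[u _ ->].
  have : \forall e \near (0 : R)^'+, 0 < e /\ cell R a v (y + e *: h u).
    near=> e; split; first by near: e; apply: nbhs_right_gt.
    near: e; apply: cell_near => // r l vrl e0; have /and3P[rB lB rl] := vrl.
    rewrite !hE; congr (u 0 _); apply/idxP/(eq_coord_class cy) => //.
    by rewrite /vequiv rl e0 orbT.
  (* A single admissible step of length [e] suffices: the affine hull allows rescaling by its
     inverse. *)
  case/filter_ex => e [e0 ce].
  have := affine_hull_line e^-1 (sub_affine_hull cy) ce cy.
  by rewrite addrAC subrr add0r scalerA mulVf ?gt_eqF // scale1r.
Unshelve. all: by end_near. Qed.

End CellDimension.

(** * Path polyhedra and their dimension *)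

Section Paths.
Context {R : realType} {n : nat} (a : 'I_n.+1 -> int).

Definition path_init k (T : 'I_k.+2 -> vdata n) (i : 'I_k.+1) : vdata n :=
  T (widen_ord (leqnSn k.+1) i).

Lemma coord_trunc N (z : 'rV[R]_N.+1) j : (j < N)%N ->
  coord (trunc z) j = coord z j.
Proof.
move=> jN; rewrite -[j in LHS]/(val (Ordinal jN)) coordE mxE -coordE.
by [].
Qed.

Lemma window_trunc N (z : 'rV[R]_N.+1) j : (j + n <= N)%N ->
  window n (trunc z) j = window n z j.
Proof.
move=> jN; apply/rowP => r; rewrite !windowE coord_trunc //.
by apply: leq_trans jN; rewrite ltn_add2l.
Qed.

Lemma path_poly0 (T : 'I_1 -> vdata n) : path_poly R a T = cell R a (T ord0).
Proof.
apply/seteqP; split=> [z [_ /(_ ord0)]|z cz].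
  by congr (cell R a _); apply/rowP => r; rewrite windowE coordE.
split=> [j|i]; first by rewrite ltn_add2r ltn0.
rewrite ord1; move: cz; congr (cell R a _).
by apply/rowP => r; rewrite windowE coordE.
Qed.

Lemma satisfies_trunc k (z : 'rV[R]_(k.+1 + n)) : satisfies a z <->
  satisfies a (@trunc R (k + n) z) /\
  satisfies a (snoc (window n (@trunc R (k + n) z) k) (coord z (k + n))).
Proof.
split=> [sz|[st sl] j].
  split=> [j jk|]; last first.
    by rewrite window_trunc //; apply: satisfies_window.
  have := sz j (ltnW jk); congr (_ < #|argmin _|)%N; apply/funext => i.
  by rewrite coord_trunc //; have := ltn_ord i; lia.
move=> jk1; have /orP[/eqP->|jk] : (j == k) || (j + n < k + n)%N by lia.
  move/satisfies_snoc: sl; congr (_ < #|argmin _|)%N; apply/funext => i.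
  case: (widen_or_max i) => [->|[r ->]]; first by rewrite coord_snoc_last.
  by rewrite coord_snoc_widen window_trunc // windowE.
have := st j jk; congr (_ < #|argmin _|)%N; apply/funext => i.
by rewrite coord_trunc //; have := ltn_ord i; lia.
Qed.

(** Recursive description behind both inductions on paths: over a sequence of the shortened path,
    the fibre consists of the extensions of its last window into the last cell. *)
Lemma path_polyS k (T : 'I_k.+2 -> vdata n) : path_poly R a T =
  [set z : 'rV[R]_(k + n).+1 | path_poly R a (path_init T) (trunc z) /\
    extensions a (T ord_max) (window n (trunc z) k) (z 0 ord_max)].
Proof.
apply/seteqP; split=> z /=.
  move=> [/satisfies_trunc[st sl] cz].
  have zE : z 0 ord_max = coord z (k + n) by rewrite -coordE.
  split; last first.
    rewrite zE; split=> //; rewrite window_trunc // slide_window.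
    exact: cz ord_max.
  split=> // i; rewrite window_trunc; first exact: (cz (widen_ord _ i)).
  by rewrite leq_add2r -ltnS.
have zE : z 0 ord_max = coord z (k + n) by rewrite -coordE.
move=> [[st ct]]; rewrite zE => -[sl cl]; split; first exact/satisfies_trunc.
move=> i; case: (widen_or_max i) => [->|[r ->]].
  by move: cl; rewrite window_trunc // slide_window.
by have := ct r; rewrite window_trunc // leq_add2r -ltnS.
Qed.

Lemma psrc_last k (T : 'I_k.+2 -> vdata n) :
  psrc T ord_max = path_init T ord_max.
Proof. by []. Qed.

Lemma ptgt_last k (T : 'I_k.+2 -> vdata n) : ptgt T ord_max = T ord_max.
Proof. by congr T; apply: ord_inj. Qed.

Lemma ptgt_path_init k (T : 'I_k.+2 -> vdata n) i :
  ptgt (path_init T) i = ptgt T (widen_ord (leqnSn k) i).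
Proof. by congr T; apply: ord_inj. Qed.

Lemma is_path_path_init k (T : 'I_k.+2 -> vdata n) :
  is_path R a T -> is_path R a (path_init T).
Proof.
by move=> [Tv Te]; split=> i; [apply: Tv | rewrite ptgt_path_init; apply: Te].
Qed.

Lemma path_dS k (T : 'I_k.+2 -> vdata n) : path_d R a T =
  (path_d R a (path_init T) +
   `[< augmenting R a (path_init T ord_max) (T ord_max) >])%N.
Proof.
rewrite /path_d -!sum1_card big_mkcond big_ord_recr /= [in RHS]big_mkcond /=.
congr (_ + _)%N.
  by apply: eq_bigr => i _; rewrite !inE ptgt_path_init.
by rewrite inE ptgt_last; case: asboolP.
Qed.

Lemma open_two_points (X : set R) : open X -> X !=set0 ->
  exists t1 t2, [/\ X t1, X t2 & t1 != t2].
Proof.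
move=> oX [t Xt]; have /nbhs_ballP[e /= e0 sub] := oX _ Xt.
exists t, (t + e / 2); split=> //; last by apply/eqP; lra.
apply: sub; rewrite /ball /= opprD addrA subrr add0r normrN.
by rewrite gtr0_norm ?divr_gt0 //; lra.
Qed.

Lemma path_poly_last_cell k (T : 'I_k.+1 -> vdata n) z :
  path_poly R a T z -> cell R a (T ord_max) (window n z k).
Proof. by case=> _ /(_ ord_max). Qed.

(** Induction on the length, starting from the dimension of a cell: a rigid edge adds a coordinate
    that is an affine function of the earlier ones, an open edge adds a nonempty open fibre. *)
Lemma has_dim_path k (T : 'I_k.+1 -> vdata n) : is_path R a T ->
  has_dim (path_poly R a T) (path_d R a T + path_n T)%N.
Proof.
elim: k T => [|k IH] T pT.
  rewrite path_poly0 /path_d eq_card0 ?add0n; last by case.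
  by apply: has_dim_cell; case: pT.
have {}IH := IH _ (is_path_path_init pT).
have path_nE : path_n (path_init T) = path_n T.
  by rewrite /path_n; congr (nclasses (T _)); apply: ord_inj.
rewrite path_nE in IH; rewrite path_polyS path_dS.
have e := pT.2 ord_max; rewrite psrc_last ptgt_last in e.
have [vv _ _ _] := e.
have [rig|op] := edge_step e.
  have [r [c extE]] := rig.
  rewrite (asboolF (rigid_not_augmenting rig)) addn0.
  (* Coordinate [r] of the last window is term [k + r] of the shortened sequence. *)
  have rk : (k + r < k + n)%N by rewrite ltn_add2l.
  have := has_dim_rigid (Ordinal rk) c IH; congr (has_dim _ _).
  apply/seteqP; split=> z [pz zE]; split=> //; move: zE;
    by rewrite extE ?windowE /= -?(coordE _ (Ordinal rk)) //;
       apply: path_poly_last_cell.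
rewrite (asboolT (open_augmenting vv op)) addn1.
apply: (has_dim_open (X := fun x => extensions a (T ord_max) (window n x k))) IH _.
by move=> x /path_poly_last_cell/op[ne _ opn _]; apply: open_two_points.
Qed.

End Paths.

(** * Polyhedra and convex covers *)

Section Polyhedra.
Context {R : realType}.

Lemma dotrE N (c x : 'rV[R]_N) : dotr c x = (x *m c^T) 0 0.
Proof. by rewrite mxE; apply: eq_bigr => i _; rewrite mxE mulrC. Qed.

Lemma dotr_mulmx N N' (W : 'M[R]_(N', N)) (c : 'rV[R]_N) (x : 'rV[R]_N') :
  dotr c (x *m W) = dotr (c *m W^T) x.
Proof. by rewrite !dotrE trmx_mul trmxK mulmxA. Qed.

Lemma dotr_segment N (c x y : 'rV[R]_N) t :
  dotr c (x + t *: (y - x)) = dotr c x + t * (dotr c y - dotr c x).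
Proof.
by rewrite !dotrE mulmxDl -scalemxAl mulmxBl !mxE.
Qed.

Lemma polyhedronT N : is_polyhedron (setT : set 'rV[R]_N).
Proof. by exists [::], [::], [::]; apply/seteqP; split. Qed.

Lemma polyhedronI N (A B : set 'rV[R]_N) :
  is_polyhedron A -> is_polyhedron B -> is_polyhedron (A `&` B).
Proof.
move=> [E1 [Le1 [Lt1 ->]]] [E2 [Le2 [Lt2 ->]]].
exists (E1 ++ E2), (Le1 ++ Le2), (Lt1 ++ Lt2); apply/seteqP; split=> x /=.
  by case=> [[h1 h2 h3] [h4 h5 h6]]; split=> c; rewrite mem_cat => /orP[]; auto.
by case=> h1 h2 h3; split; split=> c cin;
  (apply: h1 || apply: h2 || apply: h3); rewrite mem_cat cin ?orbT.
Qed.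

Lemma polyhedron_preimage N N' (W : 'M[R]_(N', N)) (A : set 'rV[R]_N) :
  is_polyhedron A -> is_polyhedron [set x | A (x *m W)].
Proof.
move=> [Eq [Le [Lt ->]]].
pose g (c : 'rV[R]_N * R) := (c.1 *m W^T, c.2).
exists (map g Eq), (map g Le), (map g Lt); apply/seteqP; split=> x /=.
  case=> h1 h2 h3; split=> _ /mapP[c cin ->] /=; rewrite -dotr_mulmx; auto.
case=> h1 h2 h3; split=> c cin; rewrite dotr_mulmx.
- by apply: (h1 (g c)); apply: map_f.
- by apply: (h2 (g c)); apply: map_f.
- by apply: (h3 (g c)); apply: map_f.
Qed.

Lemma polyhedron_forall N (I : finType) (P : pred I) (A : I -> set 'rV[R]_N) :
  (forall i, is_polyhedron (A i)) ->
  is_polyhedron [set x | forall i, P i -> A i x].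
Proof.
move=> pA; have pS (s : seq I) :
    is_polyhedron [set x | forall i, i \in s -> P i -> A i x].
  elim: s => [|i s IH].
    by have := polyhedronT N; congr is_polyhedron; apply/seteqP; split.
  have [Pi|nPi] := boolP (P i); last first.
    move: IH; congr is_polyhedron; apply/seteqP; split=> x /= h j.
      by rewrite inE => /orP[/eqP ->|/h//]; rewrite (negbTE nPi).
    by move=> js; apply: h; rewrite inE js orbT.
  have := polyhedronI (pA i) IH; congr is_polyhedron.
  apply/seteqP; split=> x /=.
    by case=> h1 h2 j; rewrite inE => /orP[/eqP ->|/h2].
  move=> h; split=> [|j js]; apply: h => //; first exact: mem_head.
  by rewrite inE js orbT.
have := pS (enum P); congr is_polyhedron; apply/seteqP; split=> x /= h i.
  by move=> Pi; apply: h => //; rewrite mem_enum.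
by move=> _; apply: h.
Qed.

Lemma polyhedron_diff N (r l : 'I_N) (c : R) :
  [/\ is_polyhedron [set y : 'rV[R]_N | y 0 r - y 0 l = c],
      is_polyhedron [set y : 'rV[R]_N | y 0 r - y 0 l <= c] &
      is_polyhedron [set y : 'rV[R]_N | y 0 r - y 0 l < c]].
Proof.
pose d : 'rV[R]_N := delta_mx 0 r - delta_mx 0 l.
have dE y : dotr d y = y 0 r - y 0 l.
  have dot1 k : (y *m (delta_mx 0 k : 'rV[R]_N)^T) 0 0 = y 0 k.
    by rewrite trmx_delta -colE mxE.
  by rewrite dotrE linearB /= mulmxBr mxE [X in _ + X]mxE !dot1.
split; [exists [:: (d, c)], [::], [::] | exists [::], [:: (d, c)], [::] |
        exists [::], [::], [:: (d, c)]]; apply/seteqP; split=> y /=;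
  rewrite -dE.
- by move=> h; split=> // x; rewrite inE => /eqP ->.
- by case=> /(_ (d, c)) h _ _; apply: h; rewrite mem_head.
- by move=> h; split=> // x; rewrite inE => /eqP ->.
- by case=> _ /(_ (d, c)) h _; apply: h; rewrite mem_head.
- by move=> h; split=> // x; rewrite inE => /eqP ->.
- by case=> _ _ /(_ (d, c)) h; apply: h; rewrite mem_head.
Qed.

Lemma polyhedron_segment N (A : set 'rV[R]_N) x y t : is_polyhedron A ->
  A x -> A y -> 0 <= t <= 1 -> A (x + t *: (y - x)).
Proof.
move=> [Eq [Le [Lt ->]]] /= [x1 x2 x3] [y1 y2 y3] /andP[t0 t1].
split=> c cin; rewrite dotr_segment.
- by rewrite x1 // y1 // subrr mulr0 addr0.
- by have := x2 c cin; have := y2 c cin; nra.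
- have := x3 c cin; have := y3 c cin; move: t0; rewrite le_eqVlt.
  by case/orP => [/eqP <-|t0]; [rewrite mul0r addr0 | nra].
Qed.

Lemma window_mulmx n N (z : 'rV[R]_N) i : (i + n <= N)%N ->
  window n z i = z *m (\matrix_(j, r) (j == i + r :> nat)%:R).
Proof.
move=> iN; apply/rowP => r; rewrite windowE mxE.
have jN : (i + r < N)%N by apply: leq_trans iN; rewrite ltn_add2l.
rewrite (bigD1 (Ordinal jN)) //= mxE eqxx mulr1 big1 ?addr0.
  by rewrite -[(i + r)%N]/(val (Ordinal jN)) coordE.
by move=> j jne; rewrite mxE (_ : (_ == _) = false) ?mulr0 //; apply/negbTE.
Qed.

Lemma polyhedron_window n N i (A : set 'rV[R]_n) : (i + n <= N)%N ->
  is_polyhedron A -> is_polyhedron [set z : 'rV[R]_N | A (window n z i)].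
Proof.
move=> iN /(polyhedron_preimage (\matrix_(j < N, r < n) (j == i + r :> nat)%:R)).
by congr is_polyhedron; apply/seteqP; split=> z /=; rewrite window_mulmx.
Qed.

Lemma trunc_window N (z : 'rV[R]_N.+1) : trunc z = window N z 0.
Proof. by apply/rowP => i; rewrite windowE -coordE coord_trunc. Qed.

End Polyhedra.

(** * Cells and path sets are polyhedra *)

Section PathPolyhedra.
Context {R : realType} {n : nat} (a : 'I_n.+1 -> int).

(** Each defining condition compares a difference of two coordinates with a constant, and there are
    finitely many of them. *)
Lemma polyhedron_cell v : is_polyhedron (cell R a v).
Proof.
pose E2 (p : 'I_n * 'I_n) := vpair v p.1 p.2 && ~~ ve v p.1 p.2.
pose E3 (p : 'I_n * 'I_n) := vpair v p.1 p.2 && ve v p.1 p.2.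
pose C1 j := [set y : 'rV[R]_n | y 0 (vs v) - y 0 j <= 0].
pose C2 (p : 'I_n * 'I_n) :=
  [set y : 'rV[R]_n | y 0 p.1 - y 0 p.2 = (vm v p.1 p.2)%:~R].
pose C3 (p : 'I_n * 'I_n) :=
  [set y : 'rV[R]_n | y 0 p.2 - y 0 p.1 < - (vm v p.1 p.2)%:~R].
pose C4 (p : 'I_n * 'I_n) :=
  [set y : 'rV[R]_n | y 0 p.1 - y 0 p.2 < (vm v p.1 p.2)%:~R + 1].
pose C5 (j : 'I_n) :=
  [set y : 'rV[R]_n | y 0 (vs v) - y 0 j < - (j.+1%:Z * amplitude a)%:~R].
have p1 : is_polyhedron [set y | forall j, predT j -> C1 j y].
  by apply: (@polyhedron_forall _ _ _ predT C1) => j; have [] := @polyhedron_diff R n (vs v) j 0.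
have p2 : is_polyhedron [set y | forall p, E2 p -> C2 p y].
  apply: (@polyhedron_forall _ _ _ E2 C2) => p.
  by have [] := @polyhedron_diff R n p.1 p.2 (vm v p.1 p.2)%:~R.
have p3 : is_polyhedron [set y | forall p, E3 p -> C3 p y].
  apply: (@polyhedron_forall _ _ _ E3 C3) => p.
  by have [] := @polyhedron_diff R n p.2 p.1 (- (vm v p.1 p.2)%:~R).
have p4 : is_polyhedron [set y | forall p, E3 p -> C4 p y].
  apply: (@polyhedron_forall _ _ _ E3 C4) => p.
  by have [] := @polyhedron_diff R n p.1 p.2 ((vm v p.1 p.2)%:~R + 1).
have p5 : is_polyhedron [set y | forall j, j \notin vB v -> C5 j y].
  apply: (@polyhedron_forall _ _ _ (fun j => j \notin vB v) C5) => j.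
  by have [] := @polyhedron_diff R n (vs v) j (- (j.+1%:Z * amplitude a)%:~R).
have := polyhedronI p1 (polyhedronI p2 (polyhedronI p3 (polyhedronI p4 p5))).
congr is_polyhedron; apply/seteqP; split=> y.
  case=> h1 [h2 [h3 [h4 h5]]]; split.
  - by move=> j; rewrite -subr_le0; apply: h1.
  - move=> r l vrl e; rewrite -(h2 (r, l)) /E2 /= ?vrl //; ring.
  - move=> r l vrl e; have e3 : E3 (r, l) by rewrite /E3 /= vrl.
    by have := h3 _ e3; have := h4 _ e3; rewrite /C3 /C4 /=; lra.
  - by move=> j /h5; rewrite /C5 /=; lra.
case=> h1 h2 h3 h4; split; last split; last split; last split.
- by move=> j _; rewrite /C1 /= subr_le0.
- by move=> [r l] /andP[vrl e]; rewrite /C2 /= (h2 r l) //; ring.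
- by move=> [r l] /andP[vrl e]; have := h3 r l vrl e; rewrite /C3 /=; lra.
- by move=> [r l] /andP[vrl e]; have := h3 r l vrl e; rewrite /C4 /=; lra.
- by move=> j /h4; rewrite /C5 /=; lra.
Qed.

(** A minimum attained twice is not in itself a conjunction of linear conditions. It is eliminated
    edge by edge: a rigid edge amounts to one equation, an open edge to membership in the next
    cell. *)
Lemma polyhedron_path k (T : 'I_k.+1 -> vdata n) : is_path R a T ->
  is_polyhedron (path_poly R a T).
Proof.
elim: k T => [|k IH] T pT; first by rewrite path_poly0; apply: polyhedron_cell.
have {}IH := IH _ (is_path_path_init pT); rewrite path_polyS.
have pA : is_polyhedron
    [set z : 'rV[R]_(k + n).+1 | path_poly R a (path_init T) (trunc z)].
  have := polyhedron_window (i := 0) (leqnSn (k + n)) IH.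
  by congr is_polyhedron; apply/seteqP; split=> z /=; rewrite trunc_window.
have e := pT.2 ord_max; rewrite psrc_last ptgt_last in e.
have [[r [c extE]]|op] := edge_step e.
  have rk : (k + r < k + n)%N by rewrite ltn_add2l.
  have [pE _ _] := polyhedron_diff ord_max (widen_ord (leqnSn _) (Ordinal rk)) c.
  have := polyhedronI pA pE; congr is_polyhedron.
  apply/seteqP; split=> z [pz]; have cz := path_poly_last_cell pz;
    rewrite /= extE //= windowE -[(k + r)%N]/(val (Ordinal rk)) coordE mxE;
    by split=> //; lra.
have := polyhedronI pA (polyhedron_window (leqnn (k.+1 + n)) (polyhedron_cell (T ord_max))).
congr is_polyhedron; apply/seteqP; split=> z [pz];
  have cz := path_poly_last_cell pz; have [_ _ _ sat] := op _ cz;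
  have wE : slide (window n (trunc z) k) (z 0 ord_max) = window n z k.+1.
- by rewrite window_trunc // -coordE slide_window.
- by rewrite /= -wE => cw; split=> //; split=> //; apply: sat.
- by rewrite window_trunc // -coordE slide_window.
- by case=> _; rewrite wE.
Qed.

End PathPolyhedra.

(** * Convex sets covered by finitely many affine sets *)

Section ConvexCover.
Context {R : realType} {N : nat}.
Implicit Types (A B : set 'rV[R]_N).

Lemma has_dim_le A B dA dB : has_dim A dA -> has_dim B dB ->
  A `<=` affine_hull B -> (dA <= dB)%N.
Proof.
move=> /has_dimP[x [U [Ax <- _ UA]]] /has_dimP[y [V [By <- BV _]]] AB.
have AV z : A z -> z - y \in V by move/AB; apply: affine_hull_sub.
apply/dimvS/subvP => u /UA/(affine_hull_sub AV).
by rewrite addrAC rpredDl // AV.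
Qed.

Lemma has_dim_bound A d : has_dim A d -> (d <= N)%N.
Proof.
move=> [x [U [_ <-]]]; apply: leq_trans (dimvS (subvf U)) _.
by rewrite dimvf dim_matrix [leqLHS]mul1n.
Qed.

Lemma affine_hull_segment A p q t : affine_hull A p -> affine_hull A q ->
  affine_hull A (p + t *: (q - p)).
Proof.
move=> [h [x [c [Ax c1 ->]]]] [h' [x' [c' [Ax' c1' ->]]]].
pose y (i : 'I_h + 'I_h') := match i with inl j => x j | inr j => x' j end.
pose d (i : 'I_h + 'I_h') :=
  match i with inl j => (1 - t) * c j | inr j => t * c' j end.
have := @affine_hull_combination _ _ A _ y d; rewrite !big_sumType /=.
rewrite -!mulr_sumr c1 c1' !mulr1 subrK => h0.
have := h0 _ erefl; have Ay i : A (y i) by case: i.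
move=> /(_ Ay); congr (affine_hull A _).
under eq_bigr do rewrite -scalerA.
under [X in _ + X]eq_bigr do rewrite -scalerA.
by rewrite -!scaler_sumr scalerBl scale1r scalerBr addrAC addrA.
Qed.

(* If neither a set H nor the union of the others contains A, a segment from
   a point outside H to a point outside the others meets each affine set at
   most once, whereas it has infinitely many points. *)
Lemma convex_cover (I : eqType) (s : seq I) (H : I -> set 'rV[R]_N) A :
  (forall i p q t, H i p -> H i q -> H i (p + t *: (q - p))) ->
  (forall p q t, A p -> A q -> 0 <= t <= 1 -> A (p + t *: (q - p))) ->
  A !=set0 -> (forall x, A x -> exists2 i, i \in s & H i x) ->
  exists2 i, i \in s & A `<=` H i.
Proof.
move=> Haff Acvx [x0 Ax0]; elim: s => [|i s IH] cov.
  by have [] := cov _ Ax0.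
have [sub|/existsNP[p /not_implyP[Ap nHp]]] := pselect (A `<=` H i).
  by exists i; rewrite ?mem_head.
have [|/existsNP[q /not_implyP[Aq nHq]]] :=
    pselect (forall x, A x -> exists2 i, i \in s & H i x).
  by move/IH => [j js sub]; exists j; rewrite // inE js orbT.
(* Infinitely many distinct points strictly between [p] and [q]. *)
pose pt (j : nat) := p + (j.+2%:R^-1 : R) *: (q - p).
have inj_t (j k : nat) : (j.+2%:R^-1 : R) = k.+2%:R^-1 -> j = k.
  by move/invr_inj/eqP; rewrite eqr_nat => /eqP[].
have lineE t t' : t != t' -> forall c : R, exists b,
    p + c *: (q - p) = (p + t *: (q - p)) + b *: ((p + t' *: (q - p)) - (p + t *: (q - p))).
  move=> tt' c; have t0 : t' - t != 0 by rewrite subr_eq0 eq_sym.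
  exists ((c - t) / (t' - t)); rewrite opprD addrACA subrr add0r -scalerBl.
  by rewrite scalerA divfK // -addrA -scalerDl (addrC t) subrK.
have H2 k t t' : t != t' -> H k (p + t *: (q - p)) -> H k (p + t' *: (q - p)) ->
    forall c, H k (p + c *: (q - p)).
  by move=> tt' h1 h2 c; have [b ->] := lineE _ _ tt' c; apply: Haff.
have covs j : exists2 k, k \in s & H k (pt j).
  have Apt : A (pt j).
    apply: Acvx => //; rewrite invr_ge0 ler0n invf_le1 ?ltr0n //.
    by rewrite ler1n.
  have [k] := cov _ Apt; rewrite inE => /orP[/eqP ->|ks] Hk; last by exists k.
  (* If the sample point lay in [H i], which also contains [q], the whole line would lie there,
     including [p]. *)
  have Hq : H i q.
    have [k0] := cov _ Aq; rewrite inE => /orP[/eqP -> //|k0s] Hk0.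
    by case: nHq; exists k0.
  case: nHp; have j1 : (j.+2%:R^-1 : R) != 1.
    by rewrite invr_eq1 pnatr_eq1.
  have := @H2 i _ 1 j1 Hk; rewrite scale1r addrC subrK => /(_ Hq 0).
  by rewrite scale0r addr0.
have /choice[f fP] : forall j, exists k, k \in s /\ H k (pt j).
  by move=> j; have [k ks Hk] := covs j; exists k.
have ix j : (index (f j) s < size s)%N by rewrite index_mem; case: (fP j).
(* Pigeonhole: one more point than there are sets, so some set contains two of them, hence the whole
   line and [q]. *)
pose g (j : 'I_(size s).+1) := Ordinal (ix j).
have [/injectiveP ginj|] := boolP (injectiveb g).
  by have := leq_card g ginj; rewrite !card_ord ltnn.
case/injectivePn => j [k jk gjk].
have fjk : f j = f k.
  have /= e := congr1 val gjk.
  by rewrite -[LHS](nth_index (f j) (fP j).1) e nth_index //; case: (fP k).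
case: nHq; exists (f j); first by case: (fP j).
have jk' : (j.+2%:R^-1 : R) != k.+2%:R^-1.
  by apply: contra jk => /eqP/inj_t/ord_inj ->.
have := @H2 (f j) _ _ jk' (fP j).2; rewrite {1}fjk => /(_ (fP k).2 1).
by rewrite scale1r addrC subrK.
Qed.

End ConvexCover.

(** * Every sequence follows a path *)

Section CellData.
Context {R : realType} {n : nat} (a : 'I_n.+1 -> int).
Local Notation M := ((amplitude a)%:~R : R).
Implicit Types (B : {set 'I_n}) (y : 'rV[R]_n) (r l s q i j : 'I_n).

Definition cell_data B s y : vdata n :=
  let inB r l := [&& r \in B, l \in B & (r < l)%N] in
  VData B s
    (\matrix_(r, l) if inB r l then (floor_type (y 0 r - y 0 l)).1 else 0)
    (\matrix_(r, l) (inB r l && (floor_type (y 0 r - y 0 l)).2)).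

Lemma cell_dataE B s y r l : vpair (cell_data B s y) r l ->
  (vm (cell_data B s y) r l, ve (cell_data B s y) r l) =
  floor_type (y 0 r - y 0 l).
Proof.
by move=> vrl; rewrite /= !mxE (_ : [&& _, _ & _] = true).
Qed.

Lemma cell_cell_data B s y : (forall j, y 0 s <= y 0 j) ->
  (forall j, j \notin B -> y 0 s + j.+1%:R * M < y 0 j) ->
  cell R a (cell_data B s y) y.
Proof.
by move=> smin unb; apply/cellP; split=> // r l vrl; rewrite cell_dataE.
Qed.

(** The hypotheses bound the height of bounded coordinates above the minimum separately on the two
    sides of [s], which gives the bounds on m. Strictness before [s] passes to the other points of
    the cell through floor types. *)
Lemma is_vertex_cell_data B s y : s \in B ->
  (forall j, y 0 s <= y 0 j) -> (forall j, (j < s)%N -> y 0 s < y 0 j) ->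
  (forall j, j \notin B -> y 0 s + j.+1%:R * M < y 0 j) ->
  (forall j, j \in B -> (s < j)%N -> y 0 j <= y 0 s + n%:R * M) ->
  (forall j, j \in B -> (j < s)%N -> y 0 j <= y 0 s + (n + s - j)%:R * M) ->
  is_vertex R a (cell_data B s y).
Proof.
move=> sB smin sfst unb right_le left_le.
have cy := cell_cell_data smin unb; have M0 := amplitudeR_ge0 (R := R) a.
have vmE r l : r \in B -> l \in B -> (r < l)%N ->
    vm (cell_data B s y) r l = Num.floor (y 0 r - y 0 l).
  move=> rB lB rl; have vrl : vpair (cell_data B s y) r l.
    by rewrite /vpair /= rB lB.
  by have [] := cell_dataE vrl.
(* All bounded coordinates lie in an interval of length 2nM, whence the bound on every m(r,l). *)
have le_s l : l \in B -> y 0 l <= y 0 s + 2 * n%:R * M.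
  move=> lB; have n0 : 0 <= n%:R * M by rewrite mulr_ge0.
  case: (ltngtP s l) => [sl|ls|/val_inj <-]; last lra.
    by have := right_le _ lB sl; lra.
  apply: le_trans (left_le _ lB ls) _; rewrite lerD2l ler_wpM2r // -natrM ler_nat.
  by have := ltn_ord s; lia.
split=> //.
- split=> [l lB sl|l lB ls|r l].
  + rewrite vmE // floor_ge_int intrN intr_mul_amplitude.
    by have := right_le _ lB sl; lra.
  + rewrite vmE // -(ler_int R); apply: le_trans (floor_le _) _.
    have := left_le _ lB ls; have -> : (n + s - l)%:R = (n%:Z + s%:Z - l%:Z)%:~R :> R.
      by move: ls => /= ls; rewrite pmulrn; congr (_%:~R); lia.
    by rewrite intrM; lra.
  + move=> vrl; have /and3P[rB lB rl] := vrl; rewrite vmE // ler_norml.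
    have := le_s _ rB; have := le_s _ lB; have := smin r; have := smin l.
    rewrite floor_ge_int -(ler_int R); have := floor_le (y 0 r - y 0 l).
    by rewrite intrN !intrM; lra.
- by exists y.
- move=> y' cy'; have /cellP[s'min _ _] := cy'; split=> // j jB js.
  rewrite ltNge -subr_le0 -(mulr0z 1).
  rewrite (eq_floor_type_le 0 (cell_floor_type cy' cy jB sB)).
  by rewrite mulr0z subr_le0 -ltNge sfst.
- by move=> r l /negbTE nrl; rewrite /= !mxE -/(vpair (cell_data B s y) r l) nrl.
Qed.

Lemma exists_first_min (A : {set 'I_n}) (f : 'I_n -> R) j : j \in A ->
  exists s, first_min A f s.
Proof.
move=> jA; case: (arg_minP f jA) => m; rewrite -/(m \in A) => mA mmin.
have Pm : (m \in A) && (f m <= f m) by rewrite mA lexx.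
case: (@arg_minnP _ m (fun i => (i \in A) && (f i <= f m)) (@nat_of_ord n) Pm).
move=> s /andP[sA sm] smin; exists s; split=> // [i iA|i iA].
  by apply: le_trans sm (mmin _ iA).
rewrite ltnNge; apply: contraR; rewrite -leNgt => is_.
by apply: smin; rewrite iA (le_trans is_).
Qed.

(** One old minimiser gives an edge (E1); with at least two, the edge is (E3) or (E2) according to
    whether the new term is bounded, that is, within nM of the minimum of its window. *)
Lemma cell_data_edge B B' s s' y x q : q.+1 = n ->
  let v := cell_data B s y in let w := cell_data B' s' (slide y x) in
  is_vertex R a v -> is_vertex R a w -> cell R a v y -> cell R a w (slide y x) ->
  satisfies a (snoc y x) ->
  (forall r, (r.+1 < n)%N -> (r \in B') = (r \in Bminus B)) ->
  (q \in B' <-> forall j, x <= slide y x 0 j + n%:R * M) ->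
  edge R a v w.
Proof.
move=> qn v w vv ww cy cx sx B'E qB'; have M0 := amplitudeR_ge0 (R := R) a.
have n1 : 1 * M <= n%:R * M by rewrite ler_wpM2r // -qn ler1n.
have [sB _ _ _ _] := vv.
have [s'B _ _ /(_ _ cx) s'min _] := ww.
have last_q r : r != q -> (r.+1 < n)%N.
  move=> rq; have := ltn_ord r; rewrite leq_eqVlt => /orP[/eqP rn|//].
  by case/eqP: rq; apply: ord_inj; apply: succn_inj; rewrite rn.
have BminusB' r : r \in Bminus B -> r \in B'.
  by move=> rB; rewrite B'E // (Bminus_lt rB).
have slideB r r' : r' = r.+1 :> nat -> slide y x 0 r = y 0 r'.
  by move=> r'E; rewrite slideE -r'E ?ltn_ord // coordE.
have B'plus : q \in B' -> B' = Bplus B.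
  move=> qB; apply/setP => r; rewrite (mem_Bplus _ _ qn).
  by case: (eqVneq r q) => [->|/last_q/B'E ->]; rewrite ?qB ?orbT ?orbF.
have compat : edge_compat v w.
  move=> r l r' l' vrl rE lE; have /and3P[rB lB rl] := vrl.
  have wrl : vpair w r' l'.
    rewrite /vpair !BminusB' ?(mem_Bminus _ rE) ?(mem_Bminus _ lE) //=.
    by rewrite -ltnS -rE -lE.
  have := cell_dataE wrl; rewrite (slideB _ _ rE) (slideB _ _ lE).
  by rewrite -(cell_dataE vrl) => -[].
have [t0 t0S t0x] := satisfies_last_ge sx; rewrite -(vSE sB cy) in t0S.
split=> //; have [S2|S1] := ltnP 1 #|vS R a v|; last first.
  have /cards1P[t tE] : #|vS R a v| == 1%N.
    by rewrite eqn_leq S1 card_gt0; apply/set0Pn; exists t0.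
  apply: Or31; rewrite (vSE sB cy) in tE.
  have xE := (satisfies_snoc_uniq x tE).1 sx.
  (* The forced term is tied with the minimum, so it exceeds each remaining term by at most M: it is
     always bounded. *)
  have qB : q \in B'.
    apply/qB' => j; case: (eqVneq j q) => [->|/last_q jn].
      by rewrite (slide_last _ _ qn); lra.
    have tmin : t \in argmin (fun i => y 0 i + (acoef a i)%:~R) by rewrite tE set11.
    rewrite (slideB _ (Ordinal jn)) // xE.
    have := argminP _ _ tmin (Ordinal jn).
    have := le_amplitudeR (R := R) a (widen_ord (leqnSn n) (Ordinal jn)) ord_max.
    by rewrite /acoef; lra.
  exists t, y, (slide y x); split=> //; first by rewrite (vSE sB cy).
  - by rewrite xE.
  - exact: B'plus.
  - move=> r q' rB q'n; have -> : q' = q by apply: ord_inj; lia.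
    have wrq : vpair w r q.
      by rewrite /vpair /= BminusB' // qB /=; have := Bminus_lt rB; lia.
    by have := cell_dataE wrq; case.
have S2' := S2; rewrite (vSE sB cy) in S2'.
have [qB|qB] := boolP (q \in B'); [apply: Or33 | apply: Or32]; last first.
  have B'minus : B' = Bminus B.
    apply/setP => r; case: (eqVneq r q) => [->|/last_q/B'E //].
    by rewrite (negbTE qB); apply/esym/negP => /Bminus_lt; rewrite qn ltnn.
  split=> //; exists y => //; case: s'min => h1 h2 h3.
  have sE i : i \in B' -> coord y i.+1 = slide y x 0 i.
    by rewrite B'minus => /Bminus_lt ilt; rewrite slideE.
  by rewrite -B'minus; split=> // i iB; rewrite !sE //; [apply: h2 | apply: h3].
split=> //.
(* Of two distinct minimisers at least one has positive index. *)
have [t [tS tpos tmin]] : exists t, is_t R a v t.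
  have [i [i0 iS]] : exists i, (0 < i)%N /\ i \in vS R a v.
    have /card_gt1P[i [j [iS jS ij]]] := S2.
    have [i0|i0] := posnP i; last by exists i.
    exists j; split=> //; rewrite lt0n; apply: contra ij => /eqP j0.
    by rewrite -val_eqE /= i0 j0.
  have Pi : (i \in vS R a v) && (0 < i)%N by rewrite iS.
  case: (@arg_minnP _ i (fun j => (j \in vS R a v) && (0 < j)%N) (@nat_of_ord n) Pi).
  move=> t /andP[tS tpos] tmin; exists t; split=> // j jS jpos.
  by apply: tmin; rewrite jS.
have t1n : (t.-1 < n)%N by have := ltn_ord t; lia.
have t1E : t = (Ordinal t1n).+1 :> nat by rewrite /= prednK.
have tB : t \in B.
  by apply: (argmin_bounded (v := v) cy); rewrite -(vSE sB cy).
have t1B : Ordinal t1n \in Bminus B by rewrite (mem_Bminus _ t1E).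
have [s0 s0min] := exists_first_min (fun i => coord y i.+1) t1B.
have [s0B _ _] := s0min.
have vpq r : r \in Bminus B -> vpair w r q.
  by move=> rB; rewrite /vpair /= BminusB' // qB /=; have := Bminus_lt rB; lia.
exists t, (Ordinal t1n), s0, q; split=> //.
- by split=> //; exists y.
- exact: B'plus.
- have wE := cell_dataE (vpq _ t1B).
  (* The bound m + e <= a_n - a_t is an inequality on the ceiling of y_t - x, hence the comparison
     y_t + a_t <= x + a_n. *)
  suff : slide y x 0 (Ordinal t1n) - slide y x 0 q <= (a ord_max - acoef a t)%:~R.
    by rewrite floor_type_le -wE => h; rewrite lerBrDr; exact: h.
  rewrite (slideB _ t) // (slide_last _ _ qn) intrB.
  rewrite (vSE sB cy) in tS; have := argminP _ _ tS t0; lra.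
- have [-> _] := cell_dataE (vpq _ s0B).
  rewrite floor_ge_int intrN intr_mul_amplitude (slide_last _ _ qn).
  by have := qB'.1 qB s0; lra.
Qed.

End CellData.

(** * Reading a path off a sequence *)

Section Covering.
Context {R : realType} {n : nat} (a : 'I_n.+1 -> int) (n_gt0 : (0 < n)%N).
Context {k : nat} (z : 'rV[R]_(k + n)) (sz : satisfies a z).
Local Notation M := ((amplitude a)%:~R : R).
Local Notation W i := (window n z i).

Lemma window_min_succ i (s : 'I_n) : (i < k)%N ->
  exists l, W i.+1 0 l <= W i 0 s + M.
Proof.
move=> ik; have iN : (i + n < k + n)%N by rewrite ltn_add2r.
have [l] := slide_min_le s (satisfies_window sz iN).
by rewrite slide_window; exists l.
Qed.

(** A term other than the last already belongs to the previous window; for the last one, some old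
    minimiser is at most M above it. *)
Lemma window_min_pred i (s : 'I_n) : (i < k)%N ->
  exists l, W i 0 l <= W i.+1 0 s + M.
Proof.
move=> ik; have iN : (i + n < k + n)%N by rewrite ltn_add2r.
have M0 := amplitudeR_ge0 (R := R) a.
have := ltn_ord s; rewrite leq_eqVlt => /orP[/eqP sn|sn]; last first.
  by exists (Ordinal sn); rewrite !windowE addSnnS; lra.
have [t _ tle] := satisfies_last_ge (satisfies_window sz iN).
exists t; rewrite [X in _ <= X + _]windowE addSnnS sn.
have := le_amplitudeR (R := R) a ord_max (widen_ord (leqnSn n) t).
rewrite /acoef in tle; lra.
Qed.

Lemma window_min_addn i d (s : 'I_n) : (i + d <= k)%N ->
  exists l, W (i + d) 0 l <= W i 0 s + d%:R * M.
Proof.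
elim: d => [|d IH] ik; first by exists s; rewrite addn0; lra.
have [|l lE] := IH; first by rewrite addnS in ik; apply: ltnW.
rewrite addnS in ik *; have [l' l'E] := window_min_succ l ik.
by exists l'; rewrite -natr1 mulrDl; lra.
Qed.

Lemma window_min_subn i d (s : 'I_n) : (i + d <= k)%N ->
  exists l, W i 0 l <= W (i + d) 0 s + d%:R * M.
Proof.
elim: d s => [|d IH] s ik; first by exists s; rewrite addn0; lra.
rewrite addnS in ik *; have [l' l'E] := window_min_pred s ik.
have [|l lE] := IH l'; first exact: ltnW.
by exists l; rewrite -natr1 mulrDl; lra.
Qed.

(* A term is bounded when it is close to the minimum of the window in which it
   appears for the first time. *)
Definition bounded_term (q : nat) : bool :=
  [forall l : 'I_n,
     coord z q <= coord z (q - n.-1 + l) + (minn q.+1 n)%:R * M].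

(** Boundedness depends only on the position [i + j], so shifting the window shifts the set; this
    gives compatibility along edges. *)
Definition bounded_set (i : nat) : {set 'I_n} :=
  [set j : 'I_n | bounded_term (i + j)]%SET.

(** The term at position [i + j] first appears in window [i + j - n.-1]; truncated subtraction gives
    window 0 for the initial terms. Positions count from 0, hence the successor under [minn]. *)
Lemma bounded_setP i (j : 'I_n) : reflect
  (forall l, W i 0 j <= W (i + j - n.-1) 0 l + (minn (i + j).+1 n)%:R * M)
  (j \in bounded_set i).
Proof.
by rewrite inE; apply: (iffP forallP) => h l; have := h l; rewrite !windowE.
Qed.

(** Between the first appearance of the term and window [i] the minimum rises by at most M per step,
    and the number of steps is below the allowed tolerance. *)
Lemma first_min_bounded i (s : 'I_n) : (i <= k)%N ->
  (forall j, W i 0 s <= W i 0 j) -> s \in bounded_set i.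
Proof.
move=> ik smin; have M0 := amplitudeR_ge0 (R := R) a.
apply/bounded_setP => l; have sn := ltn_ord s.
have [|l'] := @window_min_addn (i + s - n.-1) (i - (i + s - n.-1)) l; first lia.
rewrite subnKC; last lia.
have : (i - (i + s - n.-1))%:R * M <= (minn (i + s).+1 n)%:R * M.
  by rewrite ler_wpM2r // ler_nat; lia.
by have := smin l'; lra.
Qed.

Lemma unbounded_gt i (s j : 'I_n) : (i <= k)%N ->
  (forall j, W i 0 s <= W i 0 j) -> j \notin bounded_set i ->
  W i 0 s + j.+1%:R * M < W i 0 j.
Proof.
move=> ik smin jB; rewrite inE negb_forall in jB.
have /existsP[l] := jB; rewrite -ltNge => jl; have jn := ltn_ord j.
have [|l'] := @window_min_addn (i + j - n.-1) (i - (i + j - n.-1)) l; first lia.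
rewrite subnKC; last lia.
(* The tolerance is exactly the number of steps since the first appearance plus [j.+1]: the steps
   pay for the drift of the minimum, the rest is the threshold of the cell. *)
have jE : (minn (i + j).+1 n)%:R = (i - (i + j - n.-1))%:R + j.+1%:R :> R.
  by rewrite -natrD; congr (_%:R); lia.
move: jl; rewrite jE mulrDl -!windowE; have := smin l'; lra.
Qed.

(** A term to the left of [j] in window [i] already lies in the window where term [j] first appears,
    so it can be compared directly. *)
Lemma bounded_le_right i (s j : 'I_n) : (s < j)%N -> j \in bounded_set i ->
  W i 0 j <= W i 0 s + n%:R * M.
Proof.
move=> sj /bounded_setP jB; have jn := ltn_ord j.
have ln : (i + s - (i + j - n.-1) < n)%N by lia.
have := jB (Ordinal ln); rewrite [X in _ <= X + _ -> _]windowE /= subnKC; last lia.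
rewrite -windowE => h; apply: le_trans h _.
by rewrite lerD2l ler_wpM2r ?amplitudeR_ge0 // ler_nat geq_minr.
Qed.

(** Here term [s] may enter later than term [j], by at most [s - j] windows; each costs one M on top
    of the tolerance. *)
Lemma bounded_le_left i (s j : 'I_n) : (i <= k)%N -> (j < s)%N ->
  j \in bounded_set i -> W i 0 j <= W i 0 s + (n + s - j)%:R * M.
Proof.
move=> ik js /bounded_setP jB; have M0 := amplitudeR_ge0 (R := R) a.
have sn := ltn_ord s; pose p := (i + j - n.-1)%N; pose p' := (i + s - n.-1)%N.
have ln : (i + s - p' < n)%N by rewrite /p'; lia.
have [|l] := @window_min_subn p (p' - p) (Ordinal ln); first by rewrite /p' /p; lia.
rewrite subnKC; last by rewrite /p' /p; lia.
rewrite [X in _ <= X + _ -> _]windowE /= subnKC; last by rewrite /p'; lia.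
rewrite -windowE; have := jB l; rewrite -/p.
have : ((p' - p) + minn (i + j).+1 n)%:R * M <= (n + s - j)%:R * M.
  by rewrite ler_wpM2r // ler_nat /p' /p; lia.
by rewrite natrD mulrDl; lra.
Qed.

Lemma exists_path : exists2 T : 'I_k.+1 -> vdata n,
  is_path R a T & path_poly R a T z.
Proof.
have [q qn] : exists q : 'I_n, q.+1 = n by apply: exists_last (Ordinal n_gt0).
have /choice[s sP] : forall i, exists s, first_min [set: 'I_n]%SET (W i 0) s.
  by move=> i; apply: (@exists_first_min _ _ _ _ q); rewrite finset.in_setT.
have smin i j : W i 0 (s i) <= W i 0 j.
  by have [_ h _] := sP i; apply: h; rewrite finset.in_setT.
pose D i := cell_data (bounded_set i) (s i) (W i).
have vD i : (i <= k)%N -> is_vertex R a (D i).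
  move=> ik; apply: is_vertex_cell_data => //.
  - exact: first_min_bounded.
  - by move=> j; have [_ _ h] := sP i; apply: h; rewrite finset.in_setT.
  - by move=> j; apply: unbounded_gt.
  - by move=> j jB sj; apply: bounded_le_right.
  - by move=> j jB js; apply: bounded_le_left.
have cD i : (i <= k)%N -> cell R a (D i) (W i).
  by move=> ik; apply: cell_cell_data => // j; apply: unbounded_gt.
exists (fun i : 'I_k.+1 => D i); last by split=> // i; apply: cD; rewrite -ltnS.
split=> [i|i]; first by apply: vD; rewrite -ltnS.
have ik := ltn_ord i; have iN : (i + n < k + n)%N by rewrite ltn_add2r.
rewrite /psrc /ptgt /= /bump leq0n add1n.
have WE : W i.+1 = slide (W i) (coord z (i + n)) by rewrite slide_window.
rewrite /D WE; apply: (cell_data_edge qn); rewrite -?WE; try exact: vD.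
- exact/vD/ltnW.
- exact/cD/ltnW.
- exact: cD.
- exact: satisfies_window.
- by move=> r rn; rewrite (mem_Bminus _ (erefl : Ordinal rn = r.+1 :> nat)) !inE addSnnS.
(* The entering term first appears in window [i.+1], at a position at least n, so its tolerance is
   exactly nM. *)
- have -> : coord z (i + n) = W i.+1 0 q by rewrite windowE addSnnS qn.
  split=> [/bounded_setP h l|h]; [|apply/bounded_setP => l];
    have := h l; rewrite addSnnS qn (_ : i + n - n.-1 = i.+1)%N ?(minn_idPr _) //; lia.
Qed.

End Covering.

(** * Finiteness of the vertex set *)

Section Finiteness.
Context {R : realType} {n : nat} (a : 'I_n.+1 -> int).

Let K : nat := `|(2 * n%:Z * amplitude a)%R|%N.
Let code := ({set 'I_n} * 'I_n * 'M['I_(K + K).+1]_n * 'M[bool]_n)%type.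

Let decode (c : code) : vdata n :=
  VData c.1.1.1 c.1.1.2 (map_mx (fun i : 'I_(K + K).+1 => i%:Z - K%:Z) c.1.2) c.2.

Lemma vertices_finite :
  exists (C : finType) (d : C -> vdata n),
    forall v, is_vertex R a v -> exists c, v = d c.
Proof.
exists code, decode => v [_ [_ _ mle] _ _ m0].
exists (vB v, vs v, map_mx (fun m : int => inord `|(m + K%:Z)%R|%N) (vm v), ve v).
case: v mle m0 => B s m e /= mle m0; congr VData.
apply/matrixP => r l; rewrite !mxE.
have : `|m r l| <= K%:Z.
  have [vrl|/m0[/= -> _]] := boolP (vpair (VData B s m e) r l); last by rewrite normr0.
  by rewrite abszE; apply: le_trans (mle _ _ vrl) (ler_norm _).
by move=> mK; rewrite inordK; lia.
Qed.

End Finiteness.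

(** An arithmetic progression works: its slope is the opposite of that of the first edge of the
    lower convex hull of the points (i, a_i), so each window attains its minimum at both ends of
    that edge. *)
Lemma trop_seqs_nonempty (R : realType) (n : nat) (a : 'I_n.+1 -> int) N :
  (0 < n)%N -> trop_seqs R a N !=set0.
Proof.
move=> n0; pose slope (i : 'I_n.+1) : R := ((a ord0)%:~R - (a i)%:~R) / i%:R.
case: (@arg_maxP _ _ _ ord_max (fun i : 'I_n.+1 => 0 < i)%N slope n0) => m m0 mmax.
exists (\row_j (j%:R * slope m)) => j jN.
have coE i : (i < N)%N -> coord (\row_(j < N) (j%:R * slope m)) i = i%:R * slope m.
  by move=> iN; rewrite -[i in LHS]/(val (Ordinal iN)) coordE mxE.
have termE (i : 'I_n.+1) : coord (\row_(j < N) (j%:R * slope m)) (j + i) +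
    (a i)%:~R = j%:R * slope m + (i%:R * slope m + (a i)%:~R).
  rewrite coE ?natrD ?mulrDl ?addrA //.
  by apply: leq_ltn_trans jN; rewrite leq_add2l -ltnS.
have min0 (i : 'I_n.+1) : (a ord0)%:~R <= i%:R * slope m + (a i)%:~R :> R.
  have [i0|i0] := posnP i.
    by rewrite i0 mul0r add0r (_ : i = ord0) //; apply: ord_inj.
  have : slope i <= slope m by apply: mmax.
  by rewrite {1}/slope ler_pdivrMr ?ltr0n //; lra.
have mE : m%:R * slope m + (a m)%:~R = (a ord0)%:~R :> R.
  by rewrite /slope mulrC divfK ?subrK // pnatr_eq0 -lt0n.
apply/argmin_gt1P; exists ord0, m; split=> [|i|i].
- by rewrite -val_eqE /= eq_sym -lt0n.
- by rewrite !termE lerD2l mul0r add0r.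
- by rewrite !termE lerD2l mE.
Qed.

(** * Dimension formula, cover by path polyhedra and Hilbert function *)

Theorem theorem0p1 (R : realType) (n : nat) (hn : (0 < n)%N)
    (a : 'I_n.+1 -> int) :
  [/\ forall (k : nat) (T : 'I_k.+1 -> vdata n), is_path R a T ->
        has_dim (path_poly R a T) (path_d R a T + path_n T)%N,
      forall k : nat,
        trop_seqs R a (k + n) =
        \bigcup_(T in [set T : 'I_k.+1 -> vdata n | is_path R a T])
          path_poly R a T &
      forall k : nat,
        (exists2 T : 'I_k.+1 -> vdata n, is_path R a T &
           trop_hilbert R a (k + n) = (path_d R a T + path_n T)%N) /\
        (forall T : 'I_k.+1 -> vdata n, is_path R a T ->
           (path_d R a T + path_n T <= trop_hilbert R a (k + n))%N)].
Proof.
have cover k : trop_seqs R a (k + n) =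
    \bigcup_(T in [set T : 'I_k.+1 -> vdata n | is_path R a T]) path_poly R a T.
  apply/seteqP; split=> z; last by case=> T _ [].
  by move=> sz; have [T pT zT] := exists_path hn sz; exists T.
split=> // [k T|k]; first exact: has_dim_path.
(* Each path polyhedron is itself a competitor in the maximum; its dimension is within the range of
   the index. *)
have lower (T : 'I_k.+1 -> vdata n) : is_path R a T ->
    (path_d R a T + path_n T <= trop_hilbert R a (k + n))%N.
  move=> pT; have dT := has_dim_path pT.
  have dN : (path_d R a T + path_n T < (k + n).+1)%N by exact: has_dim_bound dT.
  rewrite /trop_hilbert.
  apply: (@leq_bigmax_cond _ _ (fun d : 'I_(k + n).+1 => d : nat) (Ordinal dN)).
  apply/asboolP; exists (path_poly R a T); split=> //; first exact: polyhedron_path.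
  by move=> z [].
split=> //.
(* A path exists, so the maximum is over a nonempty family and is attained by some polyhedron
   [A]. *)
have [T0 pT0] : exists T : 'I_k.+1 -> vdata n, is_path R a T.
  have [z sz] := trop_seqs_nonempty R a (k + n) hn.
  by have [T pT _] := exists_path hn sz; exists T.
have [A [d [pA subA dA dE]]] : exists A d,
    [/\ is_polyhedron A, A `<=` trop_seqs R a (k + n), has_dim A d &
        d = trop_hilbert R a (k + n)].
  have dT0 := has_dim_path pT0.
  have dN : (path_d R a T0 + path_n T0 < (k + n).+1)%N by exact: has_dim_bound dT0.
  rewrite /trop_hilbert.
  have [|d /asboolP[A [pA subA dA]] dE] := @eq_bigmax_cond 'I_(k + n).+1
    [pred d : 'I_(k + n).+1 | `[< exists A : set 'rV[R]_(k + n),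
       [/\ is_polyhedron A, A `<=` trop_seqs R a (k + n) & has_dim A d] >]]
    (fun d => d : nat).
    apply/card_gt0P; exists (Ordinal dN); apply/asboolP.
    exists (path_poly R a T0); split=> //; first exact: polyhedron_path.
    by move=> z [].
  by exists A, d; split=> //; rewrite -dE.
have [C [dec decP]] := vertices_finite a (R := R).
pose path_of (c : {ffun 'I_k.+1 -> C}) (i : 'I_k.+1) : vdata n := dec (c i).
have codeP (T : 'I_k.+1 -> vdata n) : is_path R a T -> exists c, T = path_of c.
  move=> pT; have /choice[c cE] : forall i, exists c, T i = dec c.
    by move=> i; apply: decP; apply: pT.1.
  by exists [ffun i => c i]; apply/funext => i; rewrite /path_of ffunE.
(* The convex set [A] is covered by the affine hulls of finitely many path polyhedra, hence lies in
   one of them, which bounds its dimension. *)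
have [c cs subc] : exists2 c,
    c \in [seq c <- enum {ffun 'I_k.+1 -> C} | `[< is_path R a (path_of c) >]] &
    A `<=` affine_hull (path_poly R a (path_of c)).
  apply: convex_cover.
  - by move=> c p q t; apply: affine_hull_segment.
  - by move=> p q t; apply: polyhedron_segment.
  - by move/has_dimP: dA => [x [_ [Ax _ _ _]]]; exists x.
  - move=> x /subA; rewrite cover => -[T /= pT xT].
    have [c cE] := codeP _ pT; exists c; last by apply: sub_affine_hull; rewrite -cE.
    by rewrite mem_filter mem_enum andbT; apply/asboolP; rewrite -cE.
move: cs; rewrite mem_filter => /andP[/asboolP pc _].
exists (path_of c) => //; apply/eqP; rewrite eqn_leq lower // andbT -dE.
exact: has_dim_le dA (has_dim_path pc) subc.
Qed.
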